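(* Let $X$ be a locally compact roughly starlike Gromov $\delta$-hyperbolic space (with base point $z_0$ and roughly-starlike constant $M$), equipped with a Borel measure $\mu$ which is doubling on $X$ for balls of radii at most $R_0$, with doubling constant $C_d$. Let $0<\varepsilon\le\varepsilon_0(\delta)$ and \[ \beta>\beta_0:=\frac{17\log C_d}{3R_0}. \] Then $\mu_\beta$ is globally doubling on $\overline{X}_\varepsilon$ (and on $X_\varepsilon$). Moreover, let $A=A(\delta)$ be the uniformity constant of $X_\varepsilon$, let $0<a_0<\min\{\tfrac18,\tfrac1{6A}\}$, let $x\in\overline{X}_\varepsilon$ and $0<r\le 2\operatorname{diam}_\varepsilon X_\varepsilon$. Then there exists $z\in X$ with $B_\varepsilon(z,a_0r)\subset B_\varepsilon(x,r)$ and $d_\varepsilon(z)\ge 2a_0 r$. For every such $z$, \[ \mu_\beta(B_\varepsilon(x,r))\simeq \mu_\beta(B_\varepsilon(z,a_0r)), \] where the comparison constants depend only on $\delta,M,\varepsilon,C_d,R_0,\beta,a_0$.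
   Context: A curve is a continuous map from a compact interval; rectifiable curves are parametrized by arc length $ds$. A metric space is geodesic if any two points are joined by a curve whose length equals their distance. A complete unbounded geodesic metric space $X$ is Gromov $\delta$-hyperbolic ($\delta\ge0$) if for all geodesics $[x,y],[y,z],[z,x]$ in $X$, every point of $[x,y]$ lies within distance $\delta$ of $[y,z]\cup[z,x]$. $X$ is roughly starlike with respect to $z_0\in X$ with constant $M>0$ if every $x\in X$ lies within distance $M$ of some geodesic ray starting at $z_0$ (a geodesic ray is a curve $\gamma:[0,\infty)\to X$ of infinite length with $\gamma|_{[0,t]}$ a geodesic for each $t$). Uniformization: for $\varepsilon>0$ put $\rho_\varepsilon(x)=e^{-\varepsilon d(x,z_0)}$ and $d_\varepsilon(x,y)=\inf_\gamma\int_\gamma\rho_\varepsilon\,ds$, the infimum over rectifiable curves in $X$ joining $x$ to $y$. $X_\varepsilon=(X,d_\varepsilon)$, $\overline{X}_\varepsilon$ is its completion, $\partial_\varepsilon X=\overline{X}_\varepsilon\setminus X_\varepsilon$, $d_\varepsilon(x)=\operatorname{dist}_\varepsilon(x,\partial_\varepsilon X)$, and $B_\varepsilon$, $\operatorname{diam}_\varepsilon$ refer to $d_\varepsilon$ while $B$ refers to $d$. A noncomplete metric space $\Omega$ is $A$-uniform if any $x,y\in\Omega$ can be joined by an arc-length parametrized curve $\gamma:[0,l]\to\Omega$ with $l\le A\,d(x,y)$ and $\operatorname{dist}(\gamma(t),\overline\Omega\setminus\Omega)\ge \frac1A\min\{t,l-t\}$ for all $t$. Known fact (Bonk–Heinonen–Koskela):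 there is $\varepsilon_0(\delta)>0$ depending only on $\delta$ such that for $0<\varepsilon\le\varepsilon_0(\delta)$, $X_\varepsilon$ is $A$-uniform with $A$ depending only on $\delta$ and $\overline{X}_\varepsilon$ is a compact geodesic space. A Borel measure $\nu$ on a metric space is doubling for balls of radii at most $R_0$ with constant $C_d$ if $0<\nu(B(x,2r))\le C_d\nu(B(x,r))<\infty$ for all $x$ and $0<r\le R_0$; globally doubling if this holds for all $r>0$. The measure $\mu_\beta$ is defined on $X$ by $d\mu_\beta=e^{-\beta d(\cdot,z_0)}\,d\mu$ and extended to $\overline{X}_\varepsilon$ by $\mu_\beta(\partial_\varepsilon X)=0$. *)

(* Defs.v *)
From HB Require Import structures.
From mathcomp Require Import all_boot all_order all_algebra.
From mathcomp Require Import all_classical all_reals all_analysis.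
Set Implicit Arguments. Unset Strict Implicit. Unset Printing Implicit Defensive.
Import Order.TTheory GRing.Theory Num.Theory.
Local Open Scope classical_set_scope.
Local Open Scope ring_scope.

Section MetricDefs.
Variable R : realType.

Definition is_metric (T : Type) (D : T -> T -> R) : Prop :=
  (forall x y, 0 <= D x y) /\ (forall x y, D x y = 0 <-> x = y) /\
  (forall x y, D x y = D y x) /\ (forall x y z, D x z <= D x y + D y z).

Definition mball (T : Type) (D : T -> T -> R) (x : T) (r : R) : set T :=
  [set y | D x y < r].

Definition mopen (T : Type) (D : T -> T -> R) (U : set T) : Prop :=
  forall x, U x -> exists2 r, 0 < r & mball D x r `<=` U.

Definition mcompact (T : Type) (D : T -> T -> R) (K : set T) : Prop :=
  forall (I : Type) (U : I -> set T), (forall i, mopen D (U i)) ->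
    K `<=` \bigcup_(i in setT) U i ->
    exists2 F : set I, finite_set F & K `<=` \bigcup_(i in F) U i.

Definition locally_compact (T : Type) (D : T -> T -> R) : Prop :=
  forall x, exists K, mcompact D K /\ exists2 r, 0 < r & mball D x r `<=` K.

Definition mcomplete (T : Type) (D : T -> T -> R) : Prop :=
  forall u : nat -> T,
    (forall e, 0 < e -> exists N, forall m n, (N <= m)%N -> (N <= n)%N ->
        D (u m) (u n) < e) ->
    exists l, forall e, 0 < e -> exists N, forall n, (N <= n)%N -> D (u n) l < e.

Definition munbounded (T : Type) (D : T -> T -> R) : Prop :=
  forall x K, exists y, K < D x y.

(* a curve gamma : [a,b] -> T (values outside [a,b] are irrelevant) *)
Definition curve (T : Type) (D : T -> T -> R) (g : R -> T) (a b : R) : Prop :=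
  a <= b /\ forall t, a <= t <= b -> forall e, 0 < e -> exists2 h, 0 < h &
    forall t', a <= t' <= b -> `|t - t'| < h -> D (g t) (g t') < e.

Definition partition (p : nat -> R) (n : nat) (s t : R) : Prop :=
  p 0%N = s /\ p n = t /\ forall i, (i < n)%N -> p i <= p i.+1.

Definition psum (T : Type) (D : T -> T -> R) (g : R -> T) (p : nat -> R) (n : nat) : R :=
  \sum_(i < n) D (g (p i)) (g (p i.+1)).

Definition is_length (T : Type) (D : T -> T -> R) (g : R -> T) (s t L : R) : Prop :=
  (forall p n, partition p n s t -> psum D g p n <= L) /\
  (forall e, 0 < e -> exists p n, partition p n s t /\ L - e < psum D g p n).

Definition geodesic_curve (T : Type) (D : T -> T -> R) (g : R -> T) (a b : R) (x y : T) : Prop :=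
  curve D g a b /\ g a = x /\ g b = y /\ is_length D g a b (D x y).

Definition geodesic_space (T : Type) (D : T -> T -> R) : Prop :=
  forall x y, exists g a b, geodesic_curve D g a b x y.

Definition image_on (T : Type) (g : R -> T) (a b : R) : set T :=
  [set g t | t in [set t | a <= t <= b]].

Definition dist_le (T : Type) (D : T -> T -> R) (p : T) (S : set T) (c : R) : Prop :=
  forall e, 0 < e -> exists2 q, S q & D p q < c + e.

Definition gromov_hyperbolic (T : Type) (D : T -> T -> R) (delta : R) : Prop :=
  forall x y z g1 a1 b1 g2 a2 b2 g3 a3 b3,
    geodesic_curve D g1 a1 b1 x y -> geodesic_curve D g2 a2 b2 y z ->
    geodesic_curve D g3 a3 b3 z x ->
    forall p, image_on g1 a1 b1 p ->
      dist_le D p (image_on g2 a2 b2 `|` image_on g3 a3 b3) delta.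

Definition hyperbolic_space (T : Type) (D : T -> T -> R) (delta : R) : Prop :=
  is_metric D /\ mcomplete D /\ munbounded D /\ geodesic_space D /\
  0 <= delta /\ gromov_hyperbolic D delta.

Definition geodesic_ray (T : Type) (D : T -> T -> R) (g : R -> T) (z0 : T) : Prop :=
  g 0 = z0 /\ (forall t, 0 <= t -> geodesic_curve D g 0 t (g 0) (g t)) /\
  (forall K, exists2 t, 0 <= t & K < D (g 0) (g t)).

Definition roughly_starlike (T : Type) (D : T -> T -> R) (z0 : T) (M : R) : Prop :=
  0 < M /\ forall x, exists g, geodesic_ray D g z0 /\
     dist_le D x [set g t | t in [set t | 0 <= t]] M.

Definition arclength (T : Type) (D : T -> T -> R) (g : R -> T) (l : R) : Prop :=
  curve D g 0 l /\ forall s t, 0 <= s -> s <= t -> t <= l -> is_length D g s t (t - s).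

Definition rho_eps (T : Type) (D : T -> T -> R) (z0 : T) (eps : R) (x : T) : R :=
  expR (- (eps * D x z0)).

Definition d_eps (T : Type) (D : T -> T -> R) (z0 : T) (eps : R) (x y : T) : R :=
  inf [set v | exists g l, [/\ arclength D g l, g 0 = x, g l = y &
         v = fine (\int[@lebesgue_measure R]_(t in [set t : R | 0 <= t <= l])
                     (rho_eps D z0 eps (g t))%:E)]].

Definition completion_of (T Y : Type) (E : T -> T -> R) (dY : Y -> Y -> R) (iota : T -> Y) : Prop :=
  is_metric dY /\ mcomplete dY /\ (forall x y, dY (iota x) (iota y) = E x y) /\
  (forall y e, 0 < e -> exists x, dY (iota x) y < e).

Definition bdry (T Y : Type) (iota : T -> Y) : set Y := ~` range iota.

Definition uniform_space (T Y : Type) (E : T -> T -> R) (dY : Y -> Y -> R) (iota : T -> Y) (A : R) : Prop :=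
  (exists w, bdry iota w) /\
  forall x y, exists g l, [/\ arclength E g l, g 0 = x, g l = y, l <= A * E x y &
     forall t, 0 <= t <= l -> forall w, bdry iota w ->
        Num.min t (l - t) / A <= dY (iota (g t)) w].

Definition diam (T : Type) (E : T -> T -> R) : R := sup [set E x y | x in setT & y in setT].

Definition standing_space (T : Type) (D : T -> T -> R) (z0 : T) (delta M : R) : Prop :=
  hyperbolic_space D delta /\ locally_compact D /\ roughly_starlike D z0 M.

(* Bonk-Heinonen-Koskela: for 0 < eps <= eps0 delta, X_eps is (A delta)-uniform and
   its completion is a compact geodesic space. *)
Definition BHK_property (eps0 A : R -> R) : Prop :=
  forall (T Y : Type) (D : T -> T -> R) (z0 : T) (delta M eps : R)
         (dY : Y -> Y -> R) (iota : T -> Y),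
    standing_space D z0 delta M -> 0 < eps -> eps <= eps0 delta ->
    completion_of (d_eps D z0 eps) dY iota ->
    uniform_space (d_eps D z0 eps) dY iota (A delta) /\ mcompact dY setT /\ geodesic_space dY.

Definition borel_measurable (d : measure_display) (T : measurableType d) (D : T -> T -> R) : Prop :=
  (@measurable d T) = <<s [set U | mopen D U] >>.

Definition doubling_upto (d : measure_display) (T : measurableType d) (D : T -> T -> R)
  (mu : {measure set T -> \bar R}) (R0 Cd : R) : Prop :=
  forall x r, 0 < r -> r <= R0 ->
    [/\ (0 < mu (mball D x (2 * r)))%E, (mu (mball D x (2 * r)) <= Cd%:E * mu (mball D x r))%E
      & (mu (mball D x r) < +oo)%E].

(* mu_beta(S) for S a subset of X; on the completion mu_beta(S) := mu_beta(iota^-1 S)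
   since mu_beta(boundary) = 0 *)
Definition mu_beta (d : measure_display) (T : measurableType d) (D : T -> T -> R) (z0 : T)
  (mu : {measure set T -> \bar R}) (beta : R) (S : set T) : \bar R :=
  \int[mu]_(x in S) (expR (- (beta * D x z0)))%:E.

Definition globally_doubling (U : Type) (E : U -> U -> R) (nu : set U -> \bar R) : Prop :=
  exists C : R, forall x r, 0 < r ->
    [/\ (0 < nu (mball E x (2 * r)))%E, (nu (mball E x (2 * r)) <= C%:E * nu (mball E x r))%E
      & (nu (mball E x r) < +oo)%E].

Definition standing (d : measure_display) (T : measurableType d) (D : T -> T -> R) (z0 : T)
  (mu : {measure set T -> \bar R}) (delta M R0 Cd : R) : Prop :=
  standing_space D z0 delta M /\ borel_measurable D /\ 0 < R0 /\ doubling_upto D mu R0 Cd.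

End MetricDefs.

(* Main.v *)
Require Import Defs.
From mathcomp Require Import all_boot all_order all_algebra.
From mathcomp Require Import finmap.
From mathcomp Require Import all_classical all_reals all_analysis.
From mathcomp Require Import measurable_realfun ring lra.
Set Implicit Arguments. Unset Strict Implicit. Unset Printing Implicit Defensive.
Import Order.TTheory GRing.Theory Num.Theory.
Import numFieldNormedType.Exports.
Local Open Scope classical_set_scope.
Local Open Scope ring_scope.

(** Write [rho x = exp (- eps * D x z0)] and [E = d_eps D z0 eps].  Integrating [rho] along
    curves gives [rho x * (1 - exp (- eps * D x y)) / eps <= E x y], and
    [E x y <= (rho x - rho y) / eps] when [x] lies between [z0] and [y]; with rough
    starlikeness, the distance of [x] to the boundary is comparable to [rho x].

    Let [z] be at distance at least [2 * a * r] from the boundary.  If [rho z] is large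
    compared with [r], the balls [E z y < a * r] and [E z y < L * r] lie between [D]-balls of
    comparable radii at most [R0], on which [mu] is doubling and the weight is almost constant.
    Otherwise uniformity shows that, up to a bounded error, [z] lies between [z0] and every [y]
    with [E z y < L * r], so [mu_beta] of the large ball is at most a constant times
    [exp (- beta * D z z0)] times the integral of [exp (- beta * D y z)].  Packing balls of
    radius [R0 / 2] shows [mu (B x (r + R0 / 2)) <= Cd ^ 2 * mu (B x r)], so this integral is
    bounded by a multiple of [mu (B z R0)] as soon as [beta > 4 * ln Cd / R0], which is weaker
    than [beta > 17 * ln Cd / (3 * R0)]. *)

(** * Metric spaces and geodesics *)

Section MetricSpace.
Context {R : realType} {T : Type} (D : T -> T -> R).
Hypothesis metricD : is_metric D.

Lemma is_metric_ge0 x y : 0 <= D x y. Proof. by case: metricD. Qed.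

Lemma is_metric_refl x : D x x = 0. Proof. by case: metricD => _ [/(_ x x)[_ ->]]. Qed.

Lemma is_metric_eq x y : D x y = 0 -> x = y.
Proof. by case: metricD => _ [/(_ x y)[]]. Qed.

Lemma is_metric_sym x y : D x y = D y x. Proof. by case: metricD => _ [_ []]. Qed.

Lemma is_metric_triangle y x z : D x z <= D x y + D y z.
Proof. by case: metricD => _ [_ []]. Qed.

Lemma is_metric_lipschitz x y z : `|D x z - D y z| <= D x y.
Proof.
rewrite ler_norml.
have := is_metric_triangle y x z; have := is_metric_triangle x y z.
by rewrite (is_metric_sym y x); lra.
Qed.

Lemma mopen_mball x r : mopen D (mball D x r).
Proof.
move=> y xy; exists (r - D x y); first by rewrite subr_gt0.
by move=> z yz; rewrite /mball /= in xy yz *; have := is_metric_triangle y x z; lra.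
Qed.

Lemma subset_mball x y r s : D x y + r <= s -> mball D x r `<=` mball D y s.
Proof.
move=> xy_rs z; rewrite /mball /= => xz.
by have := is_metric_triangle x y z; rewrite (is_metric_sym y x); lra.
Qed.

Definition mcvg (u : nat -> T) (l : T) : Prop :=
  forall e : R, 0 < e -> \forall n \near \oo, D (u n) l < e.

Definition mcauchy (u : nat -> T) : Prop :=
  forall e : R, 0 < e -> exists N, forall m n, (N <= m)%N -> (N <= n)%N -> D (u m) (u n) < e.

Lemma mcomplete_cvg u : mcomplete D -> mcauchy u -> exists l, mcvg u l.
Proof.
by move=> /(_ u) complete /complete[l ul]; exists l => e /ul[N NP]; exists N.
Qed.

Lemma mcvg_cauchy u l : mcvg u l -> mcauchy u.
Proof.
move=> ul e e0; have [|N _ NP] := ul (e / 2); first by rewrite divr_gt0.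
exists N => m n /NP /= um /NP /= un.
have := is_metric_triangle l (u m) (u n); rewrite (is_metric_sym l). lra.
Qed.

Lemma mcvg_unique u l l' : mcvg u l -> mcvg u l' -> l = l'.
Proof.
move=> ul ul'; apply/is_metric_eq/eqP; rewrite eq_le is_metric_ge0 andbT.
apply/ler_addgt0Pl => e e0; have e20 : 0 < e / 2 by rewrite divr_gt0.
near \oo => n.
have unl : D (u n) l < e / 2 by near: n; exact: ul.
have unl' : D (u n) l' < e / 2 by near: n; exact: ul'.
have := is_metric_triangle (u n) l l'; rewrite (is_metric_sym l (u n)); lra.
Unshelve. all: by end_near. Qed.

Lemma curve_dist_continuous g a b x :
  curve D g a b -> {within `[a, b], continuous (fun t => D (g t) x)}.
Proof.
move=> [_ cg]; apply/subspace_continuousP => t; rewrite set_itvcc => tab.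
apply/cvgrPdist_lt => e e0; have [h h0 hP] := cg t tab e e0.
rewrite near_withinE; near=> t' => t'ab.
apply: le_lt_trans (is_metric_lipschitz _ _ _) _; apply: (hP _ t'ab).
by near: t'; exact: (@cvgr_dist_lt _ _ _ _ _ id t).
Unshelve. all: by end_near. Qed.

Lemma arclength_ge0 g l : arclength D g l -> 0 <= l. Proof. by case=> [[]]. Qed.

Lemma arclength_dist_le g l s t :
  arclength D g l -> 0 <= s -> s <= t -> t <= l -> D (g s) (g t) <= t - s.
Proof.
move=> [_ len] s0 st tl; have [+ _] := len s t s0 st tl.
move=> /(_ (fun i => if i is 0%N then s else t) 1%N).
by rewrite /psum big_ord1; apply; do 2![split => //]; case.
Qed.

Lemma partition_itv (p : nat -> R) n s t i :
  Defs.partition p n s t -> (i <= n)%N -> s <= p i <= t.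
Proof.
move=> [<- [<- incr]] i_le_n; apply/andP; split.
  elim: i i_le_n => // i IH i_lt_n; apply: le_trans (incr i i_lt_n).
  by apply: IH; exact: ltnW.
have mono k : (i + k <= n)%N -> p i <= p (i + k)%N.
  elim: k => [|k IH]; first by rewrite addn0.
  by rewrite addnS => ik_lt_n; apply: le_trans (incr _ ik_lt_n); apply: IH; exact: ltnW.
by rewrite -[X in _ <= p X](subnKC i_le_n); apply: mono; rewrite subnKC.
Qed.

Lemma isometric_arclength g l : 0 <= l ->
  (forall s t, 0 <= s <= l -> 0 <= t <= l -> D (g s) (g t) = `|s - t|) ->
  arclength D g l.
Proof.
move=> l0 iso; split; first split => // t tl e e0.
  by exists e => // t' t'l tt'; rewrite iso.
move=> s t s0 st tl; split => [p n pP|e e0]; last first.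
  exists (fun i => if i is 0%N then s else t), 1%N.
  split; first by do 2![split => //]; case.
  by rewrite /psum big_ord1 /= iso; [rewrite distrC ger0_norm; lra|lra|lra].
have p_itv i : (i <= n)%N -> 0 <= p i <= l by move=> /(partition_itv pP); lra.
case: pP => p0 [pn incr].
have -> : psum D g p n = \sum_(0 <= i < n) (p i.+1 - p i).
  rewrite /psum big_mkord; apply: eq_bigr => i _.
  rewrite iso ?p_itv ?(ltnW (ltn_ord i))//.
  by rewrite distrC ger0_norm// subr_ge0 incr.
by rewrite telescope_sumr// p0 pn.
Qed.

Lemma locally_lipschitz_curve_dist_le (g : R -> T) c h l : 0 < h -> 0 <= l ->
  (forall s t, 0 <= s -> s <= t -> t <= l -> t - s <= h -> D (g s) (g t) <= c * (t - s)) ->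
  D (g 0) (g l) <= c * l.
Proof.
move=> h0 l0 lip.
have steps n t : 0 <= t -> t <= l -> t <= n%:R * h -> D (g 0) (g t) <= c * t.
  elim: n t => [|n IH] t t0 tl tn.
    by rewrite (_ : t = 0) ?is_metric_refl ?mulr0//; lra.
  rewrite -natr1 mulrDl mul1r in tn.
  have [th|ht] := leP t h.
    by have := lip 0 t (lexx 0) t0 tl; rewrite subr0; exact.
  have := IH (t - h); have := lip (t - h) t.
  have := is_metric_triangle (g (t - h)) (g 0) (g t); rewrite subKr mulrBr; lra.
apply: (steps (Num.truncn (l / h)).+1) => //.
by rewrite -ler_pdivrMr//; apply: ltW; exact: truncnS_gt.
Qed.

Section Geodesic.
Context (g : R -> T) (a b : R) (x y : T).
Hypothesis geo : geodesic_curve D g a b x y.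

Lemma geodesic_additive s t : a <= s -> s <= t -> t <= b ->
  D x (g s) + D (g s) (g t) = D x (g t).
Proof.
move: geo => [_ [ga [gb [len _]]]] as_ st tb.
have := len (fun i => nth b [:: a; s; t] i) 3%N.
rewrite /psum !big_ord_recr big_ord0 /= ga gb => /(_ _).
have part : Defs.partition (fun i => nth b [:: a; s; t] i) 3 a b.
  by do 2![split => //]; case=> [|[|[|]]].
move=> /(_ part).
have := is_metric_triangle (g t) x y; have := is_metric_triangle (g s) x (g t); lra.
Qed.

Lemma geodesic_dist_surj r : 0 <= r <= D x y -> exists2 t, a <= t <= b & D x (g t) = r.
Proof.
move: geo => [cg [ga [gb _]]] r_itv; have [ab _] := cg.
have : exists2 t, t \in `[a, b] & D (g t) x = r.
  apply: IVT => //; first exact: curve_dist_continuous.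
  by rewrite ga gb is_metric_refl (is_metric_sym y) (min_idPl _) ?(max_idPr _)// is_metric_ge0.
by move=> [t]; rewrite in_itv /= is_metric_sym; exists t.
Qed.

End Geodesic.

Section GeodesicSpace.
Hypothesis geodesicD : geodesic_space D.

Lemma geodesic_param x y : exists g : R -> T, [/\ g 0 = x, g (D x y) = y &
  forall s t, 0 <= s <= D x y -> 0 <= t <= D x y -> D (g s) (g t) = `|s - t|].
Proof.
have [f [a [b geo]]] := geodesicD x y.
have add := geodesic_additive geo.
have xy0 := is_metric_ge0 x y.
have param r : exists t, 0 <= r <= D x y -> a <= t <= b /\ D x (f t) = r.
  have [/(geodesic_dist_surj geo)[t tab tr]|] := boolP (0 <= r <= D x y); last by exists 0.
  by exists t.
have [k kP] := choice param.
have dk s t : 0 <= s <= D x y -> 0 <= t <= D x y -> k s <= k t ->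
    D (f (k s)) (f (k t)) = t - s.
  move=> /kP[/andP[? ?] ds] /kP[/andP[? ?] dt] st.
  by have := add (k s) (k t); rewrite ds dt; lra.
exists (f \o k); split => /=.
- by apply/esym/is_metric_eq; have [|_ ->] := kP 0; rewrite ?lexx ?xy0.
- have [_ [_ [fb _]]] := geo.
  apply: is_metric_eq; have [|/andP[? ?] dk1] := kP (D x y); first by rewrite lexx xy0.
  by have := add (k (D x y)) b; rewrite dk1 fb; lra.
- move=> s t s_itv t_itv; have [st|/ltW ts] := leP (k s) (k t).
    have dst := dk s t s_itv t_itv st; have := is_metric_ge0 (f (k s)) (f (k t)).
    by rewrite dst => ?; rewrite distrC ger0_norm.
  have dts := dk t s t_itv s_itv ts; rewrite is_metric_sym dts ger0_norm// -dts.
  exact: is_metric_ge0.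
Qed.

Lemma geodesic_arclength x y : exists g : R -> T, [/\ g 0 = x, g (D x y) = y,
  arclength D g (D x y) &
  forall t, 0 <= t <= D x y -> D x (g t) = t /\ D (g t) y = D x y - t].
Proof.
have [g [g0 g1 iso]] := geodesic_param x y.
have xy0 := is_metric_ge0 x y.
exists g; split => //; first exact: isometric_arclength.
move=> t t_itv; rewrite -{1}g0 -{1}g1 !iso; try lra.
by rewrite sub0r normrN distrC !ger0_norm; lra.
Qed.

Lemma geodesic_point x y t : 0 <= t <= D x y ->
  exists2 z, D x z = t & D z y = D x y - t.
Proof.
by move=> t_itv; have [g [_ _ _ /(_ t t_itv)[]]] := geodesic_arclength x y; exists (g t).
Qed.

Lemma geodesic_split x y a b : 0 < a -> 0 < b -> D x y < a + b ->
  exists2 z, D x z < a & D z y < b.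
Proof.
move=> a0 b0 xyab.
have [xya|axy] := ltP (D x y) a; first by exists y => //; rewrite is_metric_refl.
have [xyb|bxy] := ltP (D x y) b; first by exists x => //; rewrite is_metric_refl.
have [|z xz zy] := @geodesic_point x y ((a + D x y - b) / 2); first lra.
by exists z; rewrite ?xz ?zy; lra.
Qed.

End GeodesicSpace.

End MetricSpace.

(** * The exponential weight and the uniformized metric *)

Section ExpWeight.
Context {R : realType} {T : Type} (D : T -> T -> R) (z : T) (b : R).

Lemma rho_eps_gt0 x : 0 < rho_eps D z b x. Proof. exact: expR_gt0. Qed.

Hypothesis metricD : is_metric D.

Lemma rho_eps_base : rho_eps D z b z = 1.
Proof. by rewrite /rho_eps is_metric_refl// mulr0 oppr0 expR0. Qed.

Hypothesis b_ge0 : 0 <= b.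

Lemma rho_eps_le1 x : rho_eps D z b x <= 1.
Proof. by rewrite expR_le1 oppr_le0 mulr_ge0// is_metric_ge0. Qed.

Lemma rho_eps_harnack x y : rho_eps D z b y <= expR (b * D x y) * rho_eps D z b x.
Proof.
rewrite /rho_eps -expRD ler_expR.
by have := ler_wpM2l b_ge0 (is_metric_triangle metricD y x z); lra.
Qed.

End ExpWeight.

Section RealLine.
Context {R : realType}.

(* [1 - exp (- x) >= x / (1 + x)] because [exp x >= 1 + x] *)
Lemma le_double_of_subr1_expRN_le (x u : R) :
  0 <= x -> u <= 2^-1 -> 1 - expR (- x) <= u -> x <= 2 * u.
Proof.
move=> x0 u2 xu; have ex := expR_ge1Dx x.
have : expR (- x) * expR x = 1 by rewrite -expRD addNr expR0.
have := expR_gt0 (- x); nra.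
Qed.

Lemma integral_cst_itv0 (c l : R) : 0 <= l ->
  (\int[lebesgue_measure]_(t in `[0%R, l]) c%:E = (c * l)%:E)%E.
Proof.
move=> l0; rewrite integral_cst//= lebesgue_measure_itv /= lte_fin.
by case: ltP => [_|?]; [rewrite sube0|rewrite mule0 (_ : l = 0) ?mulr0//; lra].
Qed.

Lemma measurable_scaled_expRN (A : set R) (c a : R) :
  measurable_fun A (EFin \o (fun t => c * expR (- (a * t)))).
Proof.
apply/measurable_EFinP; apply: measurable_funTS; apply: measurable_funM => //.
apply: measurableT_comp => //; apply: measurable_funN; exact: measurable_funM.
Qed.

Lemma integral_scaled_expRN (c a l : R) : 0 <= c -> 0 < a -> 0 <= l ->
  (\int[lebesgue_measure]_(t in `[0%R, l]) (c * expR (- (a * t)))%:E =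
   (c * (1 - expR (- (a * l))) / a)%:E)%E.
Proof.
move=> c0 a0; rewrite le_eqVlt => /predU1P[<-|l0].
  by rewrite set_itv1 integral_set1 mulr0 oppr0 expR0 subrr mulr0 mul0r.
transitivity (\int[lebesgue_measure]_(t in `[0%R, l])
    ((c / a)%:E * (exponential_pdf a t)%:E))%E.
  apply: eq_integral => t; rewrite inE /= in_itv /= => /andP[t0 _].
  by rewrite exponential_pdfE// mulNr -EFinM mulrA divfK// gt_eqF.
rewrite ge0_integralZl_EFin//; last 3 first.
- by move=> t _; rewrite lee_fin exponential_pdf_ge0// ltW.
- by apply/measurable_EFinP; apply: measurable_funTS; exact: measurable_exponential_pdf.
- by rewrite divr_ge0// ltW.
have /= := exponential_prob_itv0c a l0; rewrite /exponential_prob => ->.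
by rewrite mulNr -EFinB -EFinM mulrAC.
Qed.

End RealLine.

Section UniformizedMetric.
Context {R : realType} {T : Type} (D : T -> T -> R) (z0 : T) (eps : R).
Hypothesis metricD : is_metric D.
Hypothesis geodesicD : geodesic_space D.
Hypothesis eps_gt0 : 0 < eps.

Notation rho := (rho_eps D z0 eps).
Notation E := (d_eps D z0 eps).
Notation leb := (@lebesgue_measure R).

Let eps_ge0 : 0 <= eps := ltW eps_gt0.
Let rho_gt0 x : 0 < rho x := rho_eps_gt0 D z0 eps x.

Definition rho_length (g : R -> T) (l : R) : \bar R :=
  (\int[leb]_(t in `[0%R, l]) (rho (g t))%:E)%E.

Lemma measurable_rho_curve g l : arclength D g l ->
  measurable_fun `[0, l] (EFin \o (fun t : R => rho (g t))).
Proof.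
move=> [curve_g _]; apply/measurable_EFinP.
apply: (measurableT_comp (f := expR)) => //; apply: measurable_funN.
apply: measurable_funM => //; apply: subspace_continuous_measurable_fun => //.
exact: curve_dist_continuous.
Qed.

Lemma rho_length_ge0 g l : (0 <= rho_length g l)%E.
Proof. by apply: integral_ge0 => t _; rewrite lee_fin ltW. Qed.

Lemma rho_length_le g l (f : R -> R) : arclength D g l ->
  measurable_fun `[0, l] (EFin \o f) ->
  (forall t, 0 <= t <= l -> rho (g t) <= f t) ->
  (rho_length g l <= \int[leb]_(t in `[0%R, l]) (f t)%:E)%E.
Proof.
move=> arc_g mf rho_le; apply: ge0_le_integral => //.
- by move=> t _; rewrite lee_fin ltW.
- exact: measurable_rho_curve.
Qed.

Lemma rho_length_fin g l : arclength D g l -> rho_length g l \is a fin_num.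
Proof.
move=> arc_g; rewrite ge0_fin_numE ?rho_length_ge0//.
apply: le_lt_trans (rho_length_le arc_g (measurable_cst 1%:E) _) _.
  by move=> t _; exact: rho_eps_le1.
by rewrite (integral_cst_itv0 1 (arclength_ge0 arc_g)) ltry.
Qed.

Lemma d_eps_le_rho_length g l v : arclength D g l -> (rho_length g l <= v%:E)%E ->
  E (g 0) (g l) <= v.
Proof.
move=> arc_g gv; apply: (@le_trans _ _ (fine (rho_length g l))).
  apply: ge_inf; last by exists g, l; rewrite -set_itvcc.
  by exists 0 => _ [k [m [_ _ _ ->]]]; rewrite -set_itvcc; exact: fine_ge0 (rho_length_ge0 _ _).
by rewrite -lee_fin fineK// rho_length_fin.
Qed.

Lemma d_eps_ge_rho_length x y v :
  (forall g l, arclength D g l -> g 0 = x -> g l = y -> (v%:E <= rho_length g l)%E) ->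
  v <= E x y.
Proof.
move=> v_le; have [k [k0 k1 arc_k _]] := geodesic_arclength metricD geodesicD x y.
apply: lb_le_inf; first by eexists; exists k, (D x y).
move=> _ [g [l [arc_g g0 g1 ->]]]; rewrite -set_itvcc -lee_fin fineK; first exact: v_le.
exact: rho_length_fin.
Qed.

Lemma d_eps_le_mul c x y :
  (forall z, D x z <= D x y -> rho z <= c) -> E x y <= c * D x y.
Proof.
move=> rho_c; have [g [g0 g1 arc_g dist_g]] := geodesic_arclength metricD geodesicD x y.
rewrite -{1}g0 -{1}g1; apply: d_eps_le_rho_length => //.
rewrite -integral_cst_itv0 ?is_metric_ge0//.
apply: rho_length_le => // [|t t_itv]; first exact: measurable_cst.
by apply: rho_c; have [-> _] := dist_g t t_itv; lra.
Qed.

Lemma d_eps_le_dist x y : E x y <= D x y.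
Proof. by rewrite -[leRHS]mul1r; apply: d_eps_le_mul => z _; exact: rho_eps_le1. Qed.

Lemma d_eps_le x y : E x y <= expR (eps * D x y) * rho x * D x y.
Proof.
apply: d_eps_le_mul => z xz; apply: le_trans (rho_eps_harnack z0 metricD eps_ge0 x z) _.
by rewrite ler_pM2r// ler_expR ler_pM2l.
Qed.

Lemma d_eps_radial x y : D z0 y = D z0 x + D x y -> E x y <= (rho x - rho y) / eps.
Proof.
move=> xy; have [g [g0 g1 arc_g dist_g]] := geodesic_arclength metricD geodesicD x y.
have symD := is_metric_sym metricD.
have -> : rho x - rho y = rho x * (1 - expR (- (eps * D x y))).
  rewrite mulrBr mulr1 /rho_eps -expRD; congr (_ - expR _).
  by rewrite (symD y) xy (symD x z0); ring.
rewrite -{1}g0 -{1}g1; apply: d_eps_le_rho_length => //.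
rewrite -(integral_scaled_expRN (ltW (rho_gt0 x)) eps_gt0 (is_metric_ge0 metricD _ _)).
apply: rho_length_le => //; first exact: measurable_scaled_expRN.
move=> t t_itv; rewrite /rho_eps -expRD ler_expR.
have [_ gty] := dist_g t t_itv.
have := ler_wpM2l eps_ge0 (is_metric_triangle metricD (g t) z0 y).
by rewrite gty xy (symD (g t)) (symD x z0); lra.
Qed.

Lemma d_eps_ge x y : rho x * (1 - expR (- (eps * D x y))) / eps <= E x y.
Proof.
have symD := is_metric_sym metricD.
apply: d_eps_ge_rho_length => g l arc_g g0 g1; have l0 := arclength_ge0 arc_g.
have xyl : D x y <= l.
  by rewrite -{1}g0 -{1}g1 -{2}(subr0 l); apply: arclength_dist_le arc_g _ _ _.
apply: (@le_trans _ _ (rho x * (1 - expR (- (eps * l))) / eps)%:E).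
  by rewrite lee_fin ler_pM2r ?invr_gt0// ler_pM2l// lerB// ler_expR lerN2 ler_pM2l.
rewrite -(integral_scaled_expRN (ltW (rho_gt0 x)) eps_gt0 l0); apply: ge0_le_integral => //.
- by move=> t _; rewrite lee_fin mulr_ge0 ?expR_ge0// ltW.
- exact: measurable_scaled_expRN.
- exact: measurable_rho_curve.
move=> t; rewrite /= in_itv /= => /andP[t0 tl]; rewrite lee_fin /rho_eps -expRD ler_expR.
have := ler_wpM2l eps_ge0 (arclength_dist_le arc_g (lexx _) t0 tl).
have := ler_wpM2l eps_ge0 (is_metric_triangle metricD x (g t) z0).
by rewrite g0 subr0 (symD (g t) x); lra.
Qed.

Lemma d_eps_gt0 x y : 0 < D x y -> 0 < E x y.
Proof.
move=> xy; apply: lt_le_trans (d_eps_ge x y).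
by rewrite divr_gt0// mulr_gt0// subr_gt0 expR_lt1 oppr_lt0 mulr_gt0.
Qed.

Lemma rho_eps_lipschitz x y : rho x - rho y <= eps * E x y.
Proof.
have := d_eps_ge x y; rewrite ler_pdivrMr// (mulrC _ eps); apply: le_trans.
rewrite mulrBr mulr1 lerB// /rho_eps -expRD ler_expR.
have := ler_wpM2l eps_ge0 (is_metric_triangle metricD x y z0).
by rewrite (is_metric_sym metricD y x); lra.
Qed.

Lemma dist_le_d_eps x y : 2 * eps * E x y <= rho x -> D x y <= 2 * E x y / rho x.
Proof.
move=> Exy; have rx := rho_gt0 x.
have : eps * D x y <= 2 * (eps * E x y / rho x).
  apply: le_double_of_subr1_expRN_le; first by rewrite mulr_ge0// is_metric_ge0.
  - by rewrite ler_pdivrMr//; lra.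
  by have := d_eps_ge x y; rewrite ler_pdivrMr// ler_pdivlMr//; lra.
by rewrite -mulrA mulrCA ler_pM2l// mulrA.
Qed.

Lemma d_eps_mball_sub x r : 2 * eps * r <= rho x -> mball E x r `<=` mball D x (2 * r / rho x).
Proof.
rewrite /mball => r_rho y /= Er; have e0 : 0 < 2 * eps by rewrite mulr_gt0.
apply: le_lt_trans (dist_le_d_eps _) _.
  by apply: le_trans r_rho; rewrite ler_pM2l// ltW.
by rewrite ltr_pM2r ?invr_gt0// ltr_pM2l.
Qed.

Lemma mball_sub_d_eps x s r : 0 < s -> expR (eps * s) * rho x * s <= r ->
  mball D x s `<=` mball E x r.
Proof.
rewrite /mball => s0 sr y /= xy; apply: lt_le_trans sr.
apply: le_lt_trans (d_eps_le x y) _.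
have c0 : 0 < expR (eps * s) * rho x by rewrite mulr_gt0 ?expR_gt0.
apply: (@le_lt_trans _ _ (expR (eps * s) * rho x * D x y)); last by rewrite ltr_pM2l.
rewrite ler_wpM2r ?is_metric_ge0// ler_pM2r// ler_expR ler_pM2l//; exact: ltW.
Qed.

End UniformizedMetric.

(** * The boundary of the uniformized space *)

Definition far_from_bdry {R : realType} {T Y : Type} (dY : Y -> Y -> R) (iota : T -> Y)
    (s : R) (x : T) : Prop :=
  forall w, bdry iota w -> s <= dY (iota x) w.

(* Up to [N], [z] lies on a geodesic from [z0] to [y]: the Gromov product of [y] and [z]
   based at [z0] is at least [D z z0 - N / 2]. *)
Definition shadow {R : realType} {T : Type} (D : T -> T -> R) (z0 : T) (N : R) (z : T) : set T :=
  [set y | D z z0 + D y z <= D y z0 + N].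

Definition whitney_const {R : realType} (eps M : R) : R :=
  expR (eps * (M + 1)) * (M + 1 + eps^-1).

Definition shadow_width {R : realType} (eps M A a L : R) : R :=
  4 * A ^+ 2 * whitney_const eps M * (L + 1) / a.

Lemma whitney_const_gt0 {R : realType} (eps M : R) :
  0 < eps -> 0 < M -> 0 < whitney_const eps M.
Proof. by move=> e0 M0; rewrite mulr_gt0 ?expR_gt0// !addr_gt0// invr_gt0. Qed.

Section Completion.
Context {R : realType} {T Y : Type} (D : T -> T -> R) (z0 : T) (eps : R).
Context (dY : Y -> Y -> R) (iota : T -> Y).
Hypothesis metricD : is_metric D.
Hypothesis geodesicD : geodesic_space D.
Hypothesis eps_gt0 : 0 < eps.
Hypothesis completionY : completion_of (d_eps D z0 eps) dY iota.

Notation rho := (rho_eps D z0 eps).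
Notation E := (d_eps D z0 eps).
Notation far := (far_from_bdry dY iota).

Let metricY : is_metric dY. Proof. by case: completionY. Qed.
Let isoY x y : dY (iota x) (iota y) = E x y. Proof. by case: completionY => _ [_ []]. Qed.
Let denseY y e : 0 < e -> exists x, dY (iota x) y < e.
Proof. by case: completionY => _ [_ [_]]; exact. Qed.
Let symY := is_metric_sym metricY.
Let triangleY := is_metric_triangle metricY.
Let rho_gt0 x : 0 < rho x := rho_eps_gt0 D z0 eps x.

Lemma is_metric_d_eps : is_metric E.
Proof.
split=> [x y|]; first by rewrite -isoY is_metric_ge0.
split=> [x y|]; last by split=> [x y|x y z]; rewrite -!isoY.
split=> [xy|->]; last by rewrite -isoY is_metric_refl.
apply: (is_metric_eq metricD); apply/eqP; rewrite eq_le is_metric_ge0// andbT leNgt.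
by apply/negP => /(d_eps_gt0 z0 metricD geodesicD eps_gt0); rewrite xy ltxx.
Qed.

Lemma preimage_completion_mball z r : iota @^-1` mball dY (iota z) r = mball E z r.
Proof. by apply/seteqP; split => y; rewrite /mball /= isoY. Qed.

Lemma mopen_completion_mball y r : mopen D (iota @^-1` mball dY y r).
Proof.
move=> x yx; have [s s0 sub] := mopen_mball metricY yx.
exists s => // x' xx'; apply: sub; rewrite /mball /= isoY.
exact: le_lt_trans (d_eps_le_dist z0 metricD geodesicD eps_gt0 x x') xx'.
Qed.

Let symE := is_metric_sym is_metric_d_eps.
Let triangleE := is_metric_triangle is_metric_d_eps.

Lemma completion_approx w : exists u : nat -> T, mcvg dY (iota \o u) w.
Proof.
have near_w n : exists x, dY (iota x) w < n.+1%:R^-1 by apply: denseY; rewrite invr_gt0 ltr0n.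
have [u uP] := choice near_w; exists u => e e0.
near=> n; apply: lt_trans (uP n) _.
by near: n; exact: (near_infty_natSinv_lt (PosNum e0)).
Unshelve. all: by end_near. Qed.

Lemma mcvg_rho_ge_range u w k : mcomplete D -> 0 < k ->
  (\forall n \near \oo, k <= rho (u n)) -> mcvg dY (iota \o u) w -> range iota w.
Proof.
move=> completeD k0 [N1 _ rho_k] uw.
have cauchyD : mcauchy D u.
  move=> e e0; pose c := Num.min (k / (2 * eps)) (e * k / 2).
  have [|N2 cauchyE] := mcvg_cauchy metricY uw (e := c).
    by rewrite lt_min !divr_gt0 ?mulr_gt0.
  exists (maxn N1 N2) => m n; rewrite !geq_max => /andP[N1m N2m] /andP[_ N2n].
  have := cauchyE m n N2m N2n; rewrite /= isoY lt_min => /andP[].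
  have km : k <= rho (u m) := rho_k m N1m.
  rewrite !ltr_pdivlMr ?mulr_gt0// => Ek Ee.
  apply: le_lt_trans (dist_le_d_eps metricD geodesicD eps_gt0 _) _.
    by apply: le_trans km; rewrite mulrC ltW.
  rewrite ltr_pdivrMr//; apply: (@lt_le_trans _ _ (e * k)); first lra.
  by rewrite ler_pM2l.
have [p up] := mcomplete_cvg completeD cauchyD.
exists p => //; apply: (mcvg_unique metricY _ uw) => e /up[N _ upN].
exists N => // n /upN /=; rewrite isoY; apply: le_lt_trans.
exact: d_eps_le_dist.
Qed.

Lemma bdry_of_rho_cvg0 u w : (forall e : R, 0 < e -> \forall n \near \oo, rho (u n) < e) ->
  mcvg dY (iota \o u) w -> bdry iota w.
Proof.
move=> rho0 uw [p _ pw]; have p0 := rho_gt0 p.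
near \oo => n.
have un : rho (u n) < rho p / 2 by near: n; apply: rho0; rewrite divr_gt0.
have : dY (iota (u n)) w < rho p / (2 * eps).
  by near: n; apply: uw; rewrite divr_gt0// mulr_gt0.
rewrite -pw isoY symE ltr_pdivlMr ?mulr_gt0//.
by have := rho_eps_lipschitz z0 metricD geodesicD eps_gt0 p (u n); lra.
Unshelve. all: by end_near. Qed.

Lemma far_from_bdry_rho x : mcomplete D -> far (rho x / eps) x.
Proof.
move=> completeD w bw; rewrite leNgt; apply/negP; rewrite ltr_pdivlMr// mulrC => xw.
have [u uw] := completion_approx w; apply: bw.
set k := rho x - eps * dY (iota x) w.
have k0 : 0 < k by rewrite subr_gt0.
apply: (mcvg_rho_ge_range completeD (k := k / 2) _ _ uw); first by rewrite divr_gt0.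
near=> n.
have : dY (iota (u n)) w < k / (2 * eps).
  by near: n; apply: uw; rewrite divr_gt0// mulr_gt0.
rewrite ltr_pdivlMr ?mulr_gt0// => unw.
have := rho_eps_lipschitz z0 metricD geodesicD eps_gt0 x (u n); rewrite -isoY.
have := ler_wpM2l (ltW eps_gt0) (triangleY w (iota x) (iota (u n))).
by rewrite (symY w) /k in unw *; lra.
Unshelve. all: by end_near. Qed.

Lemma rho_eps_lt x e : 0 < e -> (eps * e)^-1 <= D z0 x -> rho x < e.
Proof.
move=> e0; rewrite invfM mulrC ler_pdivrMr// mulrC (is_metric_sym metricD) => ex.
rewrite /rho_eps expRN invf_plt ?posrE ?expR_gt0//.
by have := expR_ge1Dx (eps * D x z0); lra.
Qed.

Section Ray.
Context (g : R -> T).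
Hypothesis ray : geodesic_ray D g z0.

Lemma ray_additive s t : 0 <= s -> s <= t -> D z0 (g t) = D z0 (g s) + D (g s) (g t).
Proof.
move: ray => [<- [geo _]] s0 st; apply: esym.
exact: (geodesic_additive metricD (geo t (le_trans s0 st))).
Qed.

Lemma ray_d_eps_le s t : 0 <= s -> s <= t -> E (g s) (g t) <= rho (g s) / eps.
Proof.
move=> s0 st; apply: le_trans (d_eps_radial metricD geodesicD eps_gt0 (ray_additive s0 st)) _.
by rewrite ler_pM2r ?invr_gt0// gerBl ltW.
Qed.

Lemma ray_endpoint : exists k : nat -> R, exists w,
  [/\ forall n, 0 <= k n, forall n, n%:R < D z0 (g (k n)), bdry iota w &
      mcvg dY (iota \o g \o k) w].
Proof.
have far_param n : exists t, 0 <= t /\ n%:R < D z0 (g t).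
  by case: ray => [<- [_ /(_ n%:R)[t t0 tn]]]; exists t.
have [k kP] := choice far_param.
have k0 n : 0 <= k n by case: (kP n).
have kn n : n%:R < D z0 (g (k n)) by case: (kP n).
have rho0 (e : R) : 0 < e -> \forall n \near \oo, rho (g (k n)) < e.
  move=> e0; near=> n; apply: rho_eps_lt => //; apply: le_trans (ltW (kn n)).
  by near: n; exact: nbhs_infty_ger.
have cauchy : mcauchy dY (iota \o (g \o k)).
  move=> e e0; have [|N _ NP] := rho0 (eps * e); first by rewrite mulr_gt0.
  exists N => m n Nm Nn; rewrite /= isoY.
  wlog mn : m n Nm Nn / k m <= k n.
    by move=> H; have [|/ltW] := leP (k m) (k n); [|rewrite symE]; exact: H.
  apply: le_lt_trans (ray_d_eps_le (k0 m) mn) _; rewrite ltr_pdivrMr// mulrC.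
  exact: NP.
have [_ [completeY _]] := completionY.
have [w kw] := mcomplete_cvg completeY cauchy.
by exists k, w; split => //; exact: bdry_of_rho_cvg0 kw.
Unshelve. all: by end_near. Qed.

Lemma ray_bdry_dist_le t : 0 <= t -> exists2 w, bdry iota w & dY (iota (g t)) w <= rho (g t) / eps.
Proof.
move=> t0; have [k [w [k0 kn bw kw]]] := ray_endpoint.
exists w => //; apply/ler_addgt0Pr => e e0.
near \oo => n.
have tn : t <= k n.
  rewrite leNgt; apply/negP => nt; have := ray_additive (k0 n) (ltW nt).
  have : D z0 (g t) <= n%:R by near: n; exact: nbhs_infty_ger.
  by have := is_metric_ge0 metricD (g (k n)) (g t); have := kn n; lra.
have : dY (iota (g (k n))) w < e by near: n; exact: kw.
have := ray_d_eps_le t0 tn; rewrite -isoY.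
by have := triangleY (iota (g (k n))) (iota (g t)) w; lra.
Unshelve. all: by end_near. Qed.

End Ray.

Lemma exists_bdry_dist_le M x : roughly_starlike D z0 M ->
  exists2 w, bdry iota w & dY (iota x) w <= whitney_const eps M * rho x.
Proof.
move=> [M0 starlike]; have [g [ray near_ray]] := starlike x.
have [_ [t t0 <-] xq] := near_ray 1 ltr01; rewrite /= in t0.
have [w bw qw] := ray_bdry_dist_le ray t0; exists w => //.
apply: le_trans (triangleY (iota (g t)) _ _) _; rewrite isoY.
set q := g t in xq qw *; set c := expR (eps * (M + 1)).
have cD : expR (eps * D x q) <= c by rewrite ler_expR ler_pM2l// ltW.
have -> : whitney_const eps M * rho x = c * rho x * (M + 1) + c * rho x / eps.
  by rewrite /whitney_const -/c; ring.
apply: lerD.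
  apply: le_trans (d_eps_le z0 metricD geodesicD eps_gt0 x q) _.
  apply: ler_pM; last exact: ltW.
  - by rewrite mulr_ge0 ?expR_ge0 ?ltW.
  - exact: is_metric_ge0.
  - by rewrite ler_pM2r.
apply: le_trans qw _; rewrite ler_pM2r ?invr_gt0//.
by apply: le_trans (rho_eps_harnack z0 metricD (ltW eps_gt0) x q) _; rewrite ler_pM2r.
Qed.

Lemma far_from_bdry_le_rho M s x : roughly_starlike D z0 M -> far s x ->
  s <= whitney_const eps M * rho x.
Proof. by move=> /(exists_bdry_dist_le x)[w bw xw] /(_ w bw)/le_trans; exact. Qed.

Lemma base_dist_le y : dY (iota z0) y <= eps^-1.
Proof.
apply/ler_addgt0Pr => e e0; have [x xy] := denseY y e0.
apply: le_trans (triangleY (iota x) _ _) _; rewrite isoY lerD ?(ltW xy)//.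
have : D z0 x = D z0 z0 + D z0 x by rewrite is_metric_refl// add0r.
move=> /(d_eps_radial metricD geodesicD eps_gt0) /le_trans; apply.
by rewrite rho_eps_base// ler_pdivrMr// mulVf ?gt_eqF// gerBl ltW.
Qed.

Lemma completion_dist_le y y' : dY y y' <= 2 / eps.
Proof.
have := base_dist_le y; have := base_dist_le y'.
by have := triangleY (iota z0) y y'; rewrite (symY y (iota z0)); lra.
Qed.

Lemma diam_d_eps_le : diam E <= 2 / eps.
Proof.
apply: ge_sup; first by exists (E z0 z0); exists z0 => //; exists z0.
by move=> _ [x _ [y _ <-]]; rewrite -isoY completion_dist_le.
Qed.

Lemma completion_dist_le_diam y y' : dY y y' <= diam E.
Proof.
apply/ler_addgt0Pr => e e0; have e20 : 0 < e / 2 by rewrite divr_gt0.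
have [x xy] := denseY y e20; have [x' xy'] := denseY y' e20.
have : E x x' <= diam E.
  apply: ub_le_sup; last by exists x => //; exists x'.
  by exists (2 / eps) => _ [p _ [q _ <-]]; rewrite -isoY completion_dist_le.
rewrite -isoY.
have := triangleY (iota x) y y'; have := triangleY (iota x') (iota x) y'.
by rewrite (symY y (iota x)); lra.
Qed.

Lemma completion_mball_full y r : diam E < r -> mball dY y r = setT.
Proof.
move=> diam_r; apply/seteqP; split => // y' _.
exact: le_lt_trans (completion_dist_le_diam y y') diam_r.
Qed.

Lemma munbounded_dist_gt0 : munbounded D -> exists y, 0 < E z0 y.
Proof. by move=> /(_ z0 0)[y y0]; exists y; exact: d_eps_gt0. Qed.

Lemma diam_d_eps_gt0 : munbounded D -> 0 < diam E.
Proof.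
move=> /munbounded_dist_gt0[y]; rewrite -isoY => /lt_le_trans; apply.
exact: completion_dist_le_diam.
Qed.

Lemma geodesic_point_at_height y h : 0 < h -> h <= 1 ->
  exists y', [/\ h <= rho y', E y y' <= h / eps & D y z0 = D y y' + D y' z0].
Proof.
move=> h0 h1; have [hy|yh] := leP h (rho y).
  exists y; split => //; last by rewrite is_metric_refl// add0r.
  by rewrite (is_metric_refl is_metric_d_eps) divr_ge0// ltW.
pose t := - ln h / eps.
have et : eps * t = - ln h by rewrite mulrC divfK// gt_eqF.
have symD := is_metric_sym metricD.
have t_itv : 0 <= t <= D z0 y.
  rewrite divr_ge0 ?(ltW eps_gt0) ?oppr_ge0 ?ln_le0//= -(ler_pM2l eps_gt0) et.
  by rewrite lerNl -ler_expR lnK ?posrE// symD ltW.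
have [y' z0y' y'y] := geodesic_point metricD geodesicD t_itv.
have rho_y' : rho y' = h by rewrite /rho_eps symD z0y' et opprK lnK ?posrE.
exists y'; split; first by rewrite rho_y'.
  rewrite symE; apply: le_trans (d_eps_radial metricD geodesicD eps_gt0 _) _.
    by rewrite z0y' y'y; ring.
  by rewrite rho_y' ler_pM2r ?invr_gt0// gerBl ltW.
by rewrite (symD y z0) (symD y) y'y (symD y') z0y' subrK.
Qed.

Lemma d_eps_curve_dist_le g l h : 0 < h -> arclength E g l ->
  (forall t, 0 <= t <= l -> h <= rho (g t)) -> D (g 0) (g l) <= 2 / h * l.
Proof.
move=> h0 arc_g rho_h; have l0 := arclength_ge0 arc_g.
apply: (locally_lipschitz_curve_dist_le metricD (h := h / (2 * eps))) => //.
  by rewrite divr_gt0// mulr_gt0.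
move=> s t s0 st tl; rewrite ler_pdivlMr ?mulr_gt0// => step.
have hs : h <= rho (g s) by apply: rho_h; rewrite s0 (le_trans st).
have Est := arclength_dist_le arc_g s0 st tl.
have Est_h : 2 * eps * E (g s) (g t) <= h.
  by apply: le_trans step; rewrite mulrC ler_pM2r// mulr_gt0.
apply: le_trans (dist_le_d_eps metricD geodesicD eps_gt0 (le_trans Est_h hs)) _.
rewrite ler_pdivrMr//.
have -> : 2 / h * (t - s) * rho (g s) = 2 * ((t - s) * rho (g s) / h) by ring.
rewrite ler_pM2l// ler_pdivlMr//.
by apply: ler_pM => //; [exact: is_metric_ge0 is_metric_d_eps _ _|exact: ltW].
Qed.

(** * Consequences of uniformity *)

Section Uniform.
Context (A : R).
Hypothesis uniformE : uniform_space E dY iota A.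
Hypothesis unboundedD : munbounded D.

Lemma uniform_const_ge1 : 1 <= A.
Proof.
have [y E0] := munbounded_dist_gt0 unboundedD.
have [g [l [arc_g g0 gl lA _]]] := uniformE.2 z0 y.
have := arclength_dist_le arc_g (lexx 0) (arclength_ge0 arc_g) (lexx l).
by rewrite g0 gl subr0 -(ler_pM2r E0) mul1r => /le_trans; apply.
Qed.

Let A_gt0 : 0 < A := lt_le_trans ltr01 uniform_const_ge1.

Lemma exists_far_from_bdry x y t : 0 <= t -> 2 * t <= E x y ->
  exists2 z, E x z <= t & far (t / A) z.
Proof.
move=> t0 txy; have [g [l [arc_g g0 gl _ far_g]]] := uniformE.2 x y.
have := arclength_dist_le arc_g (lexx 0) (arclength_ge0 arc_g) (lexx l).
rewrite g0 gl subr0 => xyl; have tl : t <= l by lra.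
exists (g t); first by rewrite -g0 -[leRHS]subr0; apply: arclength_dist_le arc_g _ _ _.
move=> w bw; apply: le_trans (far_g t _ w bw); last by rewrite t0.
by rewrite ler_pM2r ?invr_gt0// le_min lexx /=; lra.
Qed.

Lemma corkscrew a x r : mcomplete D -> a < 1 / 8 -> a < 1 / (6 * A) ->
  0 < r -> r <= 2 * diam E ->
  exists z, mball dY (iota z) (a * r) `<=` mball dY x r /\ far (2 * a * r) z.
Proof.
move=> completeD a8 aA r0 r_diam.
have ar : a * r < r / 8 by rewrite mulrC ltr_pM2l//; lra.
have [xz0|xz0] := leP (dY x (iota z0)) (r - a * r).
  exists z0; split=> [|w bw].
    by apply: subset_mball => //; rewrite symY; lra.
  have := far_from_bdry_rho z0 completeD bw; rewrite rho_eps_base// div1r.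
  by have := diam_d_eps_le; lra.
have r10 : 0 < r / 10 by rewrite divr_gt0.
have [x' xx'] := denseY x r10; rewrite symY in xx'.
have [||z x'z far_z] := @exists_far_from_bdry x' z0 (r / 3); first lra.
  by have := triangleY (iota x') x (iota z0); rewrite isoY; lra.
exists z; split=> [|w bw].
  apply: subset_mball => //; rewrite -isoY in x'z; rewrite symY.
  by have := triangleY (iota x') x (iota z); lra.
apply: le_trans (far_z w bw); rewrite ler_pdivlMr//.
have := ltW aA; rewrite ler_pdivlMr ?mulr_gt0// -(ler_pM2r r0); lra.
Qed.

Lemma uniform_curve_far p q k : 0 <= k -> far k p -> far k q ->
  exists g l, [/\ arclength E g l, g 0 = p, g l = q, l <= A * E p q &
    forall t, 0 <= t <= l -> far (k / (2 * A)) (g t)].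
Proof.
move=> k0 far_p far_q; have [g [l [arc_g g0 gl lA far_g]]] := uniformE.2 p q.
exists g, l; split => // t /andP[t0 tl] w bw.
have kA : k / (2 * A) <= k / 2.
  by rewrite ler_wpM2l// lef_pV2 ?posrE ?mulr_gt0//; have := uniform_const_ge1; lra.
have [tk|kt] := leP t (k / 2).
  have := arclength_dist_le arc_g (lexx 0) t0 tl; rewrite g0 subr0 -isoY.
  by have := triangleY (iota (g t)) (iota p) w; have := far_p w bw; lra.
have [ltk|klt] := leP (l - t) (k / 2).
  have := arclength_dist_le arc_g t0 tl (lexx l); rewrite gl -isoY symY.
  by have := triangleY (iota (g t)) (iota q) w; have := far_q w bw; lra.
apply: le_trans (far_g t _ w bw); last by rewrite t0.
by rewrite invfM mulrA ler_pM2r ?invr_gt0// le_min !ltW.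
Qed.

Section Starlike.
Context (M : R).
Hypothesis starlikeD : roughly_starlike D z0 M.

Let W := whitney_const eps M.
Let W_gt0 : 0 < W. Proof. by apply: whitney_const_gt0 => //; case: starlikeD. Qed.

Lemma far_dist_le p q k : 0 < k -> far k p -> far k q ->
  D p q <= 4 * A ^+ 2 * W * E p q / k.
Proof.
move=> k0 far_p far_q.
have [g [l [arc_g <- <- lA far_g]]] := uniform_curve_far (ltW k0) far_p far_q.
have AW0 : 0 < 2 * A * W by do 2![apply: mulr_gt0 => //].
have h0 : 0 < k / (2 * A * W) by exact: divr_gt0.
have rho_g t : 0 <= t <= l -> k / (2 * A * W) <= rho (g t).
  move=> /far_g /(far_from_bdry_le_rho starlikeD).
  by rewrite (ler_pdivrMr _ _ AW0) ler_pdivrMr ?mulr_gt0// -/W; lra.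
apply: le_trans (d_eps_curve_dist_le h0 arc_g rho_g) _.
have -> : 4 * A ^+ 2 * W * E (g 0) (g l) / k = 2 / (k / (2 * A * W)) * (A * E (g 0) (g l)).
  by field; rewrite !gt_eqF.
by rewrite ler_pM2l// divr_gt0.
Qed.

(* From [y] climb towards [z0] up to the height [rho = eps * r / 4]; the point reached is
   as far from the boundary as [z], hence at bounded distance from it. *)
Lemma d_eps_mball_sub_shadow a L r z : mcomplete D -> 0 < a -> a <= 1 / 8 ->
  0 < r -> r <= 4 / eps -> far (2 * a * r) z ->
  mball E z (L * r) `<=` shadow D z0 (shadow_width eps M A a L) z.
Proof.
rewrite /mball => completeD a0 a8 r0 r_eps far_z y /= zy.
have h0 : 0 < eps * r / 4 by rewrite !mulr_gt0// invr_gt0.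
have h1 : eps * r / 4 <= 1 by move: r_eps; rewrite ler_pdivlMr// mulrC; lra.
have [y' [rho_y' yy' split_y']] := geodesic_point_at_height y h0 h1.
have {}yy' : E y y' <= r / 4.
  by move: yy'; rewrite (_ : eps * r / 4 / eps = r / 4)//; field; rewrite gt_eqF.
have far_y' : far (2 * a * r) y'.
  move=> w bw; apply: le_trans (far_from_bdry_rho y' completeD bw); rewrite ler_pdivlMr//.
  by have := ler_wpM2r (ltW (mulr_gt0 r0 eps_gt0)) a8; lra.
have ar0 : 0 < 2 * a * r by rewrite !mulr_gt0.
have y'z : D y' z <= 4 * A ^+ 2 * W * (L + 1) / a / 2.
  apply: le_trans (far_dist_le ar0 far_y' far_z) _.
  have -> : 4 * A ^+ 2 * W * (L + 1) / a / 2 = 4 * A ^+ 2 * W * ((L + 1) * r) / (2 * a * r).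
    by field; rewrite !gt_eqF.
  rewrite ler_pM2r ?invr_gt0// ler_pM2l; last by do 2![apply: mulr_gt0 => //]; exact: exprn_gt0.
  by have := triangleE y y' z; rewrite (symE y' y) (symE y z); lra.
have := is_metric_triangle metricD y' y z; have := is_metric_triangle metricD y' z z0.
by rewrite /shadow /= /shadow_width -/W (is_metric_sym metricD z y') split_y'; lra.
Qed.

End Starlike.

End Uniform.

End Completion.

(** * Locally doubling measures on geodesic spaces *)

Section DisjointFamily.
Context {R : realType} (d : measure_display) (T : measurableType d) (I : choiceType).
Context (mu : {measure set T -> \bar R}) (F : I -> set T) (U : set T).
Hypothesis measurableU : measurable U.

Lemma fsum_measure_trivIset_le (S : set I) : finite_set S -> trivIset S F ->
  (forall i, S i -> measurable (F i)) -> (forall i, S i -> F i `<=` U) ->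
  (\sum_(i \in S) mu (F i) <= mu U)%E.
Proof.
move=> finS trivS mF FU; rewrite -measure_fin_bigcup//.
apply: le_measure; [exact/mem_set/fin_bigcup_measurable|exact/mem_set|].
by move=> y [i Si /(FU i Si)].
Qed.

Lemma finite_trivIset_measure (S : set I) (m : R) : trivIset S F ->
  (forall i, S i -> measurable (F i)) -> (forall i, S i -> F i `<=` U) ->
  0 < m -> (forall i, S i -> (m%:E <= mu (F i))%E) -> (mu U < +oo)%E -> finite_set S.
Proof.
move=> trivS mF FU m0 m_le finU; apply: contrapT => infS.
have fU : mu U \is a fin_num by rewrite ge0_fin_numE.
pose n := (Num.truncn (fine (mu U) / m)).+1.
have [X XS nX] := infinite_set_fset n infS.
have sum_le : (\sum_(i \in [set` X]) mu (F i) <= mu U)%E.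
  by apply: fsum_measure_trivIset_le => //;
    [exact: sub_trivIset trivS|move=> i /XS; exact: mF|move=> i /XS; exact: FU].
have : ((n%:R * m)%:E <= mu U)%E.
  apply: le_trans sum_le; rewrite fsbig_finite//= set_fsetK.
  apply: (@le_trans _ _ (\sum_(i <- X) m%:E)%E).
    rewrite sumEFin lee_fin big_const_seq count_predT iter_addr_0 -[m *+ _]mulr_natl.
    by rewrite ler_pM2r// ler_nat.
  by rewrite !big_seq; apply: lee_sum => i /XS; exact: m_le.
rewrite -(fineK fU) lee_fin -ler_pdivlMr// leNgt => /negP; apply.
exact: truncnS_gt.
Qed.

End DisjointFamily.

Lemma nneseries_geometric_le {R : realType} (q : R) (m : \bar R) : 0 < q -> q < 1 -> (0 <= m)%E ->
  (\sum_(n <oo) (q ^+ n)%:E * m <= ((1 - q)^-1)%:E * m)%E.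
Proof.
move=> q0 q1 m0; apply: lime_le.
  by apply: is_cvg_nneseries => n _ _; rewrite mule_ge0 ?lee_fin ?exprn_ge0// ltW.
apply: nearW => n; rewrite -ge0_sume_distrl; last by move=> i _; rewrite lee_fin exprn_ge0 ?ltW.
apply: lee_wpmul2r => //; rewrite sumEFin lee_fin -[leRHS]mul1r.
apply: le_trans (geometric_le_lim n ler01 q0 _); last by rewrite gtr0_norm.
by rewrite /series /=; under [leRHS]eq_bigr do rewrite mul1r.
Qed.

(* When the radius grows by [R0 / 2], the weight [expR (- (b * D y x))] drops by the first
   factor and the measure of the ball centred at [x] grows at most by the second. *)
Definition shell_ratio {R : realType} (R0 Cd b : R) : R := expR (- (b * (R0 / 2))) * Cd ^+ 2.

Section LocalDoubling.
Context {R : realType} (d : measure_display) (T : measurableType d).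
Context (D : T -> T -> R) (mu : {measure set T -> \bar R}) (R0 Cd : R).
Hypothesis metricD : is_metric D.
Hypothesis geodesicD : geodesic_space D.
Hypothesis borelD : borel_measurable D.
Hypothesis R0_gt0 : 0 < R0.
Hypothesis doubling_mu : doubling_upto D mu R0 Cd.

Notation B := (mball D).

Let symD := is_metric_sym metricD.
Let triangleD := is_metric_triangle metricD.

Lemma measurable_mopen U : mopen D U -> measurable U.
Proof. by move=> openU; rewrite borelD; exact: sub_sigma_algebra. Qed.

Lemma measurable_mball x r : measurable (B x r).
Proof. exact/measurable_mopen/mopen_mball. Qed.

Lemma measurable_rho_eps b z (U : set T) :
  measurable_fun U (fun y => (rho_eps D z b y)%:E).
Proof.
have measurable_dist : measurable_fun setT (fun y => D y z).
  apply: (measurability _ (RGenInftyO.measurableE R)) => _ [_ [a ->] <-].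
  rewrite setTI; apply: measurable_mopen => y /=; rewrite in_itv /= => ya.
  exists (a - D y z); first by rewrite subr_gt0.
  move=> y'; rewrite /mball /= in_itv /= => yy'.
  by have := triangleD y y' z; rewrite (symD y' y); lra.
apply/measurable_EFinP; apply: measurable_funTS.
apply: (measurableT_comp (f := expR)) => //; apply: measurable_funN.
exact: measurable_funM.
Qed.

Lemma le_measure_mball x y r s : D x y + r <= s -> (mu (B x r) <= mu (B y s))%E.
Proof.
by move=> xy_rs; apply: le_measure; do ?exact/mem_set/measurable_mball; exact: subset_mball.
Qed.

Lemma measure_mball_gt0 x r : 0 < r -> r <= 2 * R0 -> (0 < mu (B x r))%E.
Proof.
move=> r0 rR; have [] := @doubling_mu x (r / 2); [lra|lra|].
by have -> : 2 * (r / 2) = r by field.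
Qed.

Lemma measure_mball_fin x r : 0 < r -> r <= R0 -> mu (B x r) \is a fin_num.
Proof. by move=> r0 rR; rewrite ge0_fin_numE//; have [] := @doubling_mu x r r0 rR. Qed.

Lemma doubling_const_ge1 : 1 <= Cd.
Proof.
have R0_ge0 := ltW R0_gt0.
have [_ dbl _] := @doubling_mu point R0 R0_gt0 (lexx _).
have := @measure_mball_gt0 point R0 R0_gt0; have fin := measure_mball_fin point R0_gt0 (lexx _).
have := le_trans (@le_measure_mball point point R0 (2 * R0) _) dbl.
rewrite is_metric_refl// -(fineK fin) -EFinM lee_fin lte_fin => H1 H2.
have m0 : 0 < fine (mu (B point R0)) by apply: H2; lra.
by rewrite -(ler_pM2r m0) mul1r H1//; lra.
Qed.

Let Cd_ge0 : 0 <= Cd := le_trans ler01 doubling_const_ge1.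

Lemma doubling_iter k x s1 s2 : 0 < s1 -> s1 <= 2 * R0 -> s1 <= 2 ^+ k * s2 ->
  (mu (B x s1) <= (Cd ^+ k)%:E * mu (B x s2))%E.
Proof.
elim: k s1 => [|k IH] s1 s10 s1R s12.
  by rewrite !expr0 mul1e mul1r in s12 *; apply: le_measure_mball; rewrite is_metric_refl// add0r.
have [half0 halfR] : 0 < s1 / 2 /\ s1 / 2 <= R0 by split; lra.
have [_ + _] := @doubling_mu x (s1 / 2) half0 halfR.
rewrite (_ : 2 * (s1 / 2) = s1); last by field.
move=> /le_trans; apply; rewrite exprS EFinM -muleA; apply: lee_wpmul2l => //.
by apply: IH; [lra|lra|rewrite exprS in s12; lra].
Qed.

Lemma doubling_recenter x p t : 0 < t -> t <= R0 -> D x p <= t ->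
  (mu (B x t) <= Cd%:E * mu (B p t))%E.
Proof.
move=> t0 tR xp; have [_ dbl _] := @doubling_mu p t t0 tR.
by apply: le_trans dbl; apply: le_measure_mball; lra.
Qed.

Lemma doubling_chain n x p t : 0 < t -> t <= R0 -> D x p < n.+1%:R * t ->
  (mu (B x t) <= (Cd ^+ n.+1)%:E * mu (B p t))%E.
Proof.
move=> t0 tR; elim: n x => [|n IH] x.
  by rewrite mul1r expr1 => /ltW; exact: doubling_recenter.
have -> : n.+2%:R * t = t + n.+1%:R * t by rewrite -(natr1 n.+1); ring.
have nt0 : 0 < n.+1%:R * t by rewrite mulr_gt0.
move=> /(geodesic_split metricD geodesicD t0 nt0)[q /ltW xq /IH qp].
apply: le_trans (doubling_recenter t0 tR xq) _.
by rewrite (exprS Cd n.+1) EFinM -muleA; apply: lee_wpmul2l.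
Qed.

Lemma measure_mball_lower_bound x r t : 0 < t -> t <= R0 ->
  exists2 m, 0 < m & forall p, D x p < r -> (m%:E <= mu (B p t))%E.
Proof.
move=> t0 tR; pose n := Num.truncn (r / t).
have Cn0 : 0 < Cd ^+ n.+1 by rewrite exprn_gt0// (lt_le_trans ltr01) ?doubling_const_ge1.
have fin := measure_mball_fin x t0 tR.
exists (fine (mu (B x t)) / Cd ^+ n.+1) => [|p xp].
  rewrite divr_gt0// -lte_fin fineK//; apply: measure_mball_gt0 => //.
  by have := R0_gt0; lra.
have xp_n : D x p < n.+1%:R * t.
  by apply: lt_trans xp _; rewrite -ltr_pdivrMr// truncnS_gt.
have := doubling_chain t0 tR xp_n.
rewrite -(fineK fin) -(fineK (measure_mball_fin p t0 tR)) -EFinM !lee_fin.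
by rewrite ler_pdivrMr// mulrC.
Qed.

Lemma exists_mball_packing x r t : 0 < t -> t <= R0 -> (mu (B x r) < +oo)%E ->
  exists S : set T, [/\ finite_set S, trivIset S (fun p => B p t),
    forall p, S p -> B p t `<=` B x r &
    forall y, D x y < r - t -> exists2 p, S p & D y p < 2 * t].
Proof.
move=> t0 tR finr; pose P : set T := [set p | D x p < r - t].
have [S [SP trivS maxS]] := ex_maximal_disjoint_subcollection (fun p => B p t) P.
have inB p : S p -> B p t `<=` B x r.
  by move=> /SP; rewrite /P /= => xp; apply: subset_mball => //; rewrite symD; lra.
exists S; split => // [|y Py].
  have [m m0 mP] := measure_mball_lower_bound x (r - t) t0 tR.
  apply: (finite_trivIset_measure _ trivS _ inB m0 _ finr).
  - exact: measurable_mball.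
  - by move=> p _; exact: measurable_mball.
  - by move=> p /SP; exact: mP.
apply: contrapT => far_y.
have disj p w : S p -> B p t w -> ~ B y t w.
  rewrite /mball /= => Sp pw yw; apply: far_y; exists p => //.
  by have := triangleD w y p; rewrite (symD w p); lra.
have ny : ~ S y.
  by move=> Sy; apply: far_y; exists y => //; rewrite is_metric_refl// mulr_gt0.
apply: (maxS (y |` S)).
- split; first by move=> p Sp; right.
  by move=> /(_ y) sub; apply: ny; apply: sub; left.
- by move=> p [->|/SP].
move=> p q [->|Sp] [->|Sq] [w [pw qw]] //.
- by case: (disj q w Sq qw pw).
- by case: (disj p w Sp pw qw).
- by apply: trivS => //; exists w.
Qed.

Lemma doubling_growth_step x r t : 0 < t -> 2 * t <= R0 -> t < r -> (mu (B x r) < +oo)%E ->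
  (mu (B x (r + t)) <= (Cd ^+ 2)%:E * mu (B x r))%E.
Proof.
move=> t0 tR tr finr; have tR0 : t <= R0 by lra.
have [S [finS trivS SB netS]] := exists_mball_packing t0 tR0 finr.
have cover : B x (r + t) `<=` \bigcup_(p in S) B p (4 * t).
  move=> y; rewrite /mball /= => xy.
  have [|||y' xy' y'y] := @geodesic_split _ _ D metricD geodesicD x y (r - t) (2 * t); try lra.
  have [p Sp y'p] := netS y' xy'; exists p => //=.
  by have := triangleD y' p y; rewrite (symD p y'); lra.
apply: le_trans (content_sub_fsum mu finS _ _ cover) _.
- by move=> p _; exact: measurable_mball.
- exact: measurable_mball.
apply: (@le_trans _ _ (\sum_(p \in S) (Cd ^+ 2)%:E * mu (B p t))%E).
  by apply: lee_fsum => // p _; apply: doubling_iter; lra.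
rewrite -ge0_mule_fsumr//; apply: lee_wpmul2l; first by rewrite lee_fin exprn_ge0.
apply: fsum_measure_trivIset_le => //; first exact: measurable_mball.
by move=> p _; exact: measurable_mball.
Qed.

Lemma doubling_growth n x : (mu (B x (R0 + n%:R * (R0 / 2))) < +oo)%E /\
  (mu (B x (R0 + n%:R * (R0 / 2))) <= (Cd ^+ 2 ^+ n)%:E * mu (B x R0))%E.
Proof.
have R1 := R0_gt0.
elim: n => [|n [finn IH]].
  by rewrite mul0r addr0 expr0 mul1e; split => //; have [] := @doubling_mu x R0 R0_gt0 (lexx _).
have n0 : 0 <= n%:R * (R0 / 2) by rewrite mulr_ge0// divr_ge0// ltW.
have -> : R0 + n.+1%:R * (R0 / 2) = R0 + n%:R * (R0 / 2) + R0 / 2 by rewrite -natr1; ring.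
have step : (mu (B x (R0 + n%:R * (R0 / 2) + R0 / 2)) <=
    (Cd ^+ 2)%:E * mu (B x (R0 + n%:R * (R0 / 2))))%E.
  by apply: doubling_growth_step => //; lra.
split.
  apply: le_lt_trans step _; rewrite -ge0_fin_numE// in finn.
  by rewrite -(fineK finn) -EFinM ltry.
apply: le_trans step _; rewrite (exprS (Cd ^+ 2)) (EFinM (Cd ^+ 2)) -muleA.
by apply: lee_wpmul2l; rewrite ?lee_fin ?exprn_ge0.
Qed.

Lemma integral_rho_eps_le_shells b t x : 0 <= b -> 0 < t ->
  (\int[mu]_y (rho_eps D x b y)%:E <=
   \sum_(n <oo) (expR (- (b * (n%:R * t))))%:E * mu (B x (n.+1%:R * t)))%E.
Proof.
move=> b0 t0.
pose f n y : \bar R := ((expR (- (b * (n%:R * t))))%:E * (\1_(B x (n.+1%:R * t)) y)%:E)%E.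
have f0 n y : (0 <= f n y)%E by rewrite mule_ge0 ?lee_fin ?expR_ge0.
have mindic n : measurable_fun setT (fun y => (\1_(B x (n.+1%:R * t)) y)%:E : \bar R).
  by apply/measurable_EFinP/measurable_indic; exact: measurable_mball.
have mf n : measurable_fun setT (f n) by exact: measurable_funeM.
have rho_le y : ((rho_eps D x b y)%:E <= \sum_(n <oo) f n y)%E.
  have yx0 : 0 <= D y x / t by rewrite divr_ge0 ?is_metric_ge0// ltW.
  have /andP[] := truncn_itv yx0; set n := Num.truncn _.
  rewrite ler_pdivlMr// ltr_pdivrMr// => n_le n_gt.
  apply: (@le_trans _ _ (f n y)).
    rewrite /f indicE mem_set; last by rewrite /mball /= symD.
    by rewrite mule1 lee_fin ler_expR lerN2 ler_wpM2l.
  apply: le_trans (nneseries_lim_ge n.+1 (fun k _ _ => f0 k y)).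
  by rewrite big_nat_recr//= leeDr// sume_ge0.
apply: (@le_trans _ _ (\int[mu]_y \sum_(n <oo) f n y)%E).
  apply: ge0_le_integral => //.
  - by move=> y _; rewrite lee_fin expR_ge0.
  - exact: measurable_rho_eps.
  - by apply: ge0_emeasurable_sum => // n y _; exact: f0.
rewrite integral_nneseries//; apply: lee_nneseries => n *; first exact: integral_ge0.
rewrite /f ge0_integralZl_EFin ?expR_ge0// integral_indic ?setIT//.
exact: measurable_mball.
Qed.

Lemma integral_rho_eps_le b x : 0 <= b -> shell_ratio R0 Cd b < 1 ->
  (\int[mu]_y (rho_eps D x b y)%:E <= ((1 - shell_ratio R0 Cd b)^-1)%:E * mu (B x R0))%E.
Proof.
move=> b0; set q := shell_ratio R0 Cd b => q1; have t0 : 0 < R0 / 2 by rewrite divr_gt0.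
have q0 : 0 < q.
  by rewrite mulr_gt0 ?expR_gt0// exprn_gt0// (lt_le_trans ltr01) ?doubling_const_ge1.
apply: le_trans (integral_rho_eps_le_shells x b0 t0) _.
apply: le_trans (nneseries_geometric_le q0 q1 (measure_ge0 mu _)).
apply: lee_nneseries => n *; first by rewrite mule_ge0 ?lee_fin ?expR_ge0.
have -> : q ^+ n = expR (- (b * (n%:R * (R0 / 2)))) * (Cd ^+ 2) ^+ n.
  by rewrite /q /shell_ratio exprMn -expRM_natl; congr (expR _ * _); ring.
rewrite (EFinM (expR _)) -muleA; apply: lee_wpmul2l; first by rewrite lee_fin expR_ge0.
have [_] := doubling_growth n x; apply: le_trans; apply: le_measure_mball.
by rewrite is_metric_refl// -natr1; lra.
Qed.

End LocalDoubling.

(** * The weighted measure *)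

Definition mass_comparable {R : realType} {T : Type} (nu : set T -> \bar R) (C : R)
    (S V : set T) : Prop :=
  [/\ (0 < nu S)%E, (nu V <= C%:E * nu S)%E & (nu V < +oo)%E].

Lemma mass_comparableW {R : realType} {T : Type} (nu : set T -> \bar R) (C C' : R)
    (S S' V V' : set T) :
  0 <= C -> C <= C' -> (nu S <= nu S')%E -> (nu V' <= nu V)%E ->
  mass_comparable nu C S V -> mass_comparable nu C' S' V'.
Proof.
move=> C0 CC' SS' VV' [S0 VS finV]; split.
- exact: lt_le_trans SS'.
- by apply: le_trans VV' (le_trans VS _); apply: lee_pmul => //; exact: ltW.
- exact: le_lt_trans finV.
Qed.

Section WeightedMeasure.
Context {R : realType} (d : measure_display) (T : measurableType d).
Context (D : T -> T -> R) (z0 : T) (mu : {measure set T -> \bar R}) (R0 Cd eps beta : R).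
Hypothesis metricD : is_metric D.
Hypothesis geodesicD : geodesic_space D.
Hypothesis borelD : borel_measurable D.
Hypothesis R0_gt0 : 0 < R0.
Hypothesis doubling_mu : doubling_upto D mu R0 Cd.
Hypothesis eps_gt0 : 0 < eps.
Hypothesis beta_ge0 : 0 <= beta.

Notation rho := (rho_eps D z0 eps).
Notation weight := (rho_eps D z0 beta).
Notation E := (d_eps D z0 eps).
Notation nu := (mu_beta D z0 mu beta).
Notation B := (mball D).

Let measurable_B := measurable_mball metricD borelD.
Let weight_ge0 x : 0 <= weight x := ltW (rho_eps_gt0 D z0 beta x).
Let measurable_rho b z (U : set T) : measurable_fun U (fun y => (rho_eps D z b y)%:E).
Proof. exact: measurable_rho_eps. Qed.
Let Cd_ge0 : 0 <= Cd :=
  le_trans ler01 (doubling_const_ge1 metricD borelD R0_gt0 doubling_mu).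

Lemma le_mu_beta (U V : set T) : measurable U -> measurable V -> U `<=` V ->
  (nu U <= nu V)%E.
Proof.
by move=> mU mV UV; apply: ge0_subset_integral => //; exact: measurable_rho.
Qed.

Lemma mu_beta_ge_cst (U : set T) c : measurable U -> 0 <= c ->
  (forall y, U y -> c <= weight y) -> (c%:E * mu U <= nu U)%E.
Proof.
move=> mU c0 cU; rewrite -integral_cst//; apply: ge0_le_integral => //.
exact: measurable_rho.
Qed.

Lemma mu_beta_le_cst (U : set T) c : measurable U ->
  (forall y, U y -> weight y <= c) -> (nu U <= c%:E * mu U)%E.
Proof.
move=> mU cU; rewrite -integral_cst//; apply: ge0_le_integral => //.
exact: measurable_rho.
Qed.

Lemma mu_beta_mball_ge z s :
  ((expR (- (beta * s)) * weight z)%:E * mu (B z s) <= nu (B z s))%E.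
Proof.
apply: mu_beta_ge_cst => // [|y zy]; first by rewrite mulr_ge0// expR_ge0.
rewrite expRN mulrC ler_pdivrMr ?expR_gt0// mulrC.
apply: le_trans (rho_eps_harnack z0 metricD beta_ge0 y z) _.
rewrite ler_pM2r ?rho_eps_gt0// ler_expR ler_wpM2l// (is_metric_sym metricD); exact: ltW.
Qed.

Lemma mu_beta_mball_le z s : (nu (B z s) <= (expR (beta * s) * weight z)%:E * mu (B z s))%E.
Proof.
apply: mu_beta_le_cst => // y zy; apply: le_trans (rho_eps_harnack z0 metricD beta_ge0 z y) _.
rewrite ler_pM2r ?rho_eps_gt0// ler_expR ler_wpM2l//; exact: ltW.
Qed.

Lemma mu_beta_mball_gt0 z s : 0 < s -> s <= R0 -> (0 < nu (B z s))%E.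
Proof.
move=> s0 sR; apply: lt_le_trans (mu_beta_mball_ge z s).
rewrite mule_gt0 ?lte_fin ?mulr_gt0 ?expR_gt0//.
by apply: (measure_mball_gt0 doubling_mu) => //; have := R0_gt0; lra.
Qed.

Lemma mu_beta_mball_lty z s : 0 < s -> s <= R0 -> (nu (B z s) < +oo)%E.
Proof.
move=> s0 sR; apply: le_lt_trans (mu_beta_mball_le z s) _.
by rewrite -(fineK (measure_mball_fin doubling_mu z s0 sR)) -EFinM ltry.
Qed.

Lemma mu_beta_doubling_iter k z s1 s2 : 0 < s1 -> s1 <= R0 -> s2 <= R0 -> s1 <= 2 ^+ k * s2 ->
  (nu (B z s1) <= (expR (2 * beta * R0) * Cd ^+ k)%:E * nu (B z s2))%E.
Proof.
move=> s10 s1R s2R s12; have R1 := R0_gt0.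
have dbl : (mu (B z s1) <= (Cd ^+ k)%:E * mu (B z s2))%E.
  by apply: (doubling_iter metricD borelD R0_gt0 doubling_mu) => //; lra.
apply: le_trans (mu_beta_mball_le z s1) _.
apply: (@le_trans _ _ ((expR (beta * R0) * weight z)%:E * ((Cd ^+ k)%:E * mu (B z s2)))%E).
  apply: lee_pmul => //; first by rewrite lee_fin mulr_ge0 ?expR_ge0.
  by rewrite lee_fin ler_wpM2r// ler_expR ler_wpM2l.
have -> : expR (beta * R0) * weight z =
    expR (2 * beta * R0) * (expR (- (beta * R0)) * weight z).
  by rewrite mulrA -expRD; congr (expR _ * _); ring.
rewrite !(EFinM (expR (2 * beta * R0))) -!muleA.
apply: lee_wpmul2l; first by rewrite lee_fin expR_ge0.
rewrite muleCA; apply: lee_wpmul2l; first by rewrite lee_fin exprn_ge0.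
apply: le_trans (mu_beta_mball_ge z s2); apply: lee_wpmul2r => //.
by rewrite lee_fin ler_wpM2r// ler_expR lerN2 ler_wpM2l.
Qed.

Lemma mass_comparable_of_mball k c z s1 s2 (S V : set T) :
  measurable S -> 0 <= c -> 0 < s1 -> s1 <= R0 -> 0 < s2 -> s2 <= R0 -> s1 <= 2 ^+ k * s2 ->
  B z s2 `<=` S -> (nu V <= c%:E * nu (B z s1))%E ->
  mass_comparable nu (c * (expR (2 * beta * R0) * Cd ^+ k)) S V.
Proof.
move=> mS c0 s10 s1R s20 s2R s12 BS Vs1.
apply: (mass_comparableW (S := B z s2) (V := V)) (lexx _) _ (lexx _) _ => //.
- by rewrite !mulr_ge0 ?expR_ge0 ?exprn_ge0.
- exact: le_mu_beta.
split; first exact: mu_beta_mball_gt0.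
- apply: le_trans Vs1 _; rewrite EFinM -muleA; apply: lee_wpmul2l; first by rewrite lee_fin.
  exact: mu_beta_doubling_iter.
- apply: le_lt_trans Vs1 _; have := mu_beta_mball_lty z s10 s1R.
  by rewrite -ge0_fin_numE ?integral_ge0// => /fineK <-; rewrite -EFinM ltry.
Qed.

Definition tail_const (N : R) : R :=
  expR (beta * (N + R0)) * (1 - shell_ratio R0 Cd beta)^-1.

Lemma mu_beta_shadow_le N z (V : set T) : shell_ratio R0 Cd beta < 1 -> measurable V ->
  V `<=` shadow D z0 N z -> (nu V <= (tail_const N)%:E * nu (B z R0))%E.
Proof.
move=> q1 mV Vshadow.
have q0 : 0 < 1 - shell_ratio R0 Cd beta by rewrite subr_gt0.
have cw0 : 0 <= expR (beta * N) * weight z by rewrite mulr_ge0 ?expR_ge0.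
apply: (@le_trans _ _
    (\int[mu]_(y in V) ((expR (beta * N) * weight z)%:E * (rho_eps D z beta y)%:E))%E).
  apply: ge0_le_integral => //.
  - exact: measurable_rho.
  - by apply: measurable_funeM; exact: measurable_rho.
  move=> y /Vshadow; rewrite /shadow /= => yz; rewrite -EFinM lee_fin -!expRD ler_expR.
  by have := ler_wpM2l beta_ge0 yz; lra.
rewrite ge0_integralZl_EFin//; last by move=> y _; rewrite lee_fin expR_ge0.
apply: (@le_trans _ _ ((expR (beta * N) * weight z)%:E *
    ((1 - shell_ratio R0 Cd beta)^-1%:E * mu (B z R0)))%E).
  apply: lee_wpmul2l => //.
  apply: le_trans (integral_rho_eps_le metricD geodesicD borelD R0_gt0 doubling_mu z beta_ge0 q1).
  by apply: ge0_subset_integral => // y _; rewrite lee_fin expR_ge0.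
have -> : expR (beta * N) * weight z =
    expR (beta * (N + R0)) * (expR (- (beta * R0)) * weight z).
  by rewrite mulrA -expRD; congr (expR _ * _); ring.
rewrite !(EFinM (expR (beta * (N + R0)))) -!muleA.
apply: lee_wpmul2l; first by rewrite lee_fin expR_ge0.
rewrite muleCA; apply: lee_wpmul2l; first by rewrite lee_fin invr_ge0 ltW.
exact: mu_beta_mball_ge.
Qed.

Section Completion.
Context {Y : Type} (dY : Y -> Y -> R) (iota : T -> Y).
Hypothesis completionY : completion_of (d_eps D z0 eps) dY iota.

Lemma measurable_completion_mball x r : measurable (iota @^-1` mball dY x r).
Proof.
apply: (measurable_mopen borelD).
exact: mopen_completion_mball metricD geodesicD eps_gt0 completionY x r.
Qed.

Lemma measurable_d_eps_mball z r : measurable (mball E z r).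
Proof. by rewrite -(preimage_completion_mball completionY); exact: measurable_completion_mball. Qed.

Lemma mball_sub_d_eps_mball z s r : 0 < s -> s <= R0 -> expR (eps * R0) * rho z * s <= r ->
  B z s `<=` mball E z r.
Proof.
move=> s0 sR sr; apply: (mball_sub_d_eps metricD geodesicD) => //; apply: le_trans sr.
by rewrite ler_pM2r// ler_pM2r ?rho_eps_gt0// ler_expR ler_pM2l.
Qed.

Lemma mass_comparable_interior k z r1 r2 : 0 < r1 -> r1 <= r2 ->
  2 * eps * r2 <= rho z -> 2 * r2 <= R0 * rho z -> 2 * expR (eps * R0) * r2 <= 2 ^+ k * r1 ->
  mass_comparable nu (expR (2 * beta * R0) * Cd ^+ k) (mball E z r1) (mball E z r2).
Proof.
move=> r10 r12 r2eps r2R r21.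
have rho0 : 0 < rho z := rho_eps_gt0 D z0 eps z.
have r20 : 0 < r2 := lt_le_trans r10 r12.
have c0 : 0 < expR (eps * R0) * rho z by rewrite mulr_gt0// expR_gt0.
have c_ge : rho z <= expR (eps * R0) * rho z.
  by apply: ler_peMl; [exact: ltW|rewrite ltW// expR_gt1 mulr_gt0].
set s1 := 2 * r2 / rho z; set s2 := r1 / (expR (eps * R0) * rho z).
have s1R : s1 <= R0 by rewrite ler_pdivrMr.
have s2R : s2 <= R0.
  rewrite ler_pdivrMr//; have := ler_wpM2l (ltW R0_gt0) c_ge; lra.
rewrite -[X in mass_comparable _ X]mul1r.
apply: (mass_comparable_of_mball (z := z) (s1 := s1) (s2 := s2)) => //.
- exact: measurable_d_eps_mball.
- by rewrite divr_gt0// mulr_gt0.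
- exact: divr_gt0.
- rewrite ler_pdivrMr// /s2.
  have -> : 2 ^+ k * (r1 / (expR (eps * R0) * rho z)) * rho z = 2 ^+ k * r1 / expR (eps * R0).
    by field; rewrite !gt_eqF ?expR_gt0.
  by rewrite ler_pdivlMr ?expR_gt0//; lra.
- apply: mball_sub_d_eps_mball => //; first exact: divr_gt0.
  by rewrite mulrC divfK// gt_eqF.
- rewrite mul1e; apply: le_mu_beta => //; first exact: measurable_d_eps_mball.
  exact: d_eps_mball_sub.
Qed.

Lemma mass_comparable_shadow k N z s r (V : set T) : shell_ratio R0 Cd beta < 1 -> measurable V ->
  V `<=` shadow D z0 N z -> 0 < s -> s <= R0 -> expR (eps * R0) * rho z * s <= r ->
  R0 <= 2 ^+ k * s ->
  mass_comparable nu (tail_const N * (expR (2 * beta * R0) * Cd ^+ k)) (mball E z r) V.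
Proof.
move=> q1 mV Vshadow s0 sR sr Rs.
apply: (mass_comparable_of_mball (z := z) (s1 := R0) (s2 := s)) => //.
- exact: measurable_d_eps_mball.
- by rewrite mulr_ge0 ?expR_ge0// invr_ge0 subr_ge0 ltW.
- exact: mball_sub_d_eps_mball.
- exact: mu_beta_shadow_le.
Qed.

End Completion.

End WeightedMeasure.

Lemma supercritical_beta_ge0 {R : realType} (R0 Cd beta : R) :
  1 <= Cd -> 0 < R0 -> 17 * ln Cd / (3 * R0) < beta -> 0 <= beta.
Proof.
move=> Cd1 R0_gt0 /ltW; apply: le_trans.
by rewrite divr_ge0 ?mulr_ge0 ?ln_ge0// ltW.
Qed.

Lemma supercritical_shell_ratio_lt1 {R : realType} (R0 Cd beta : R) :
  1 <= Cd -> 0 < R0 -> 17 * ln Cd / (3 * R0) < beta -> shell_ratio R0 Cd beta < 1.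
Proof.
move=> Cd1 R0_gt0; rewrite ltr_pdivrMr ?mulr_gt0// => beta_gt.
have lnCd := ln_ge0 Cd1.
rewrite /shell_ratio (_ : Cd ^+ 2 = expR (2 * ln Cd)).
  by rewrite -expRD expR_lt1; lra.
by rewrite expRM_natl lnK// posrE; exact: lt_le_trans Cd1.
Qed.

(** * Balls of the uniformized space *)

Lemma le_exp2_truncnS {R : realType} (x : R) : x <= 2 ^+ (Num.truncn x).+1.
Proof.
apply: le_trans (ltW (truncnS_gt x)) _.
by rewrite -natrX ler_nat ltnW// ltn_expl.
Qed.

Section ComparisonConst.
Context {R : realType} (M R0 Cd eps beta A a L : R).

(* The ball of radius [L * r] centred at [z] is treated as interior when
   [interior_threshold * r <= rho z]. *)
Definition interior_threshold : R := Num.max (2 * eps * L) (2 * L / R0).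

Definition interior_const : R :=
  expR (2 * beta * R0) * Cd ^+ (Num.truncn (2 * expR (eps * R0) * L / a)).+1.

Definition inner_radius : R := Num.min R0 (a / (expR (eps * R0) * interior_threshold)).

Definition boundary_const : R := tail_const R0 Cd beta (shadow_width eps M A a L) *
  (expR (2 * beta * R0) * Cd ^+ (Num.truncn (R0 / inner_radius)).+1).

Definition comparison_const : R := Num.max 1 (Num.max interior_const boundary_const).

Lemma comparison_const_ge1 : 1 <= comparison_const.
Proof. by rewrite le_max lexx. Qed.

Lemma comparison_const_ge0 : 0 <= comparison_const.
Proof. exact: le_trans ler01 comparison_const_ge1. Qed.

End ComparisonConst.

Section Standing.
Context {R : realType} (d : measure_display) (T : measurableType d) (Y : Type).
Context (D : T -> T -> R) (z0 : T) (mu : {measure set T -> \bar R}).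
Context (dY : Y -> Y -> R) (iota : T -> Y) (delta M R0 Cd eps beta A : R).
Hypothesis standingD : standing D z0 mu delta M R0 Cd.
Hypothesis completionY : completion_of (d_eps D z0 eps) dY iota.
Hypothesis uniformE : uniform_space (d_eps D z0 eps) dY iota A.
Hypothesis eps_gt0 : 0 < eps.
Hypothesis beta_gt : 17 * ln Cd / (3 * R0) < beta.

Notation rho := (rho_eps D z0 eps).
Notation E := (d_eps D z0 eps).
Notation nu := (mu_beta D z0 mu beta).
Notation nuY := (fun S => nu (iota @^-1` S)).
Notation far := (far_from_bdry dY iota).
Notation C := (comparison_const M R0 Cd eps beta A).

Let metricD : is_metric D. Proof. by case: standingD => [[[]]]. Qed.
Let completeD : mcomplete D. Proof. by case: standingD => [[[_ []]]]. Qed.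
Let unboundedD : munbounded D. Proof. by case: standingD => [[[_ [_ []]]]]. Qed.
Let geodesicD : geodesic_space D. Proof. by case: standingD => [[[_ [_ [_ []]]]]]. Qed.
Let starlikeD : roughly_starlike D z0 M. Proof. by case: standingD => [[_ []]]. Qed.
Let borelD : borel_measurable D. Proof. by case: standingD => _ []. Qed.
Let R0_gt0 : 0 < R0. Proof. by case: standingD => _ [_ []]. Qed.
Let doubling_mu : doubling_upto D mu R0 Cd. Proof. by case: standingD => _ [_ []]. Qed.
Let metricY : is_metric dY. Proof. by case: completionY. Qed.

Let Cd_ge1 : 1 <= Cd := doubling_const_ge1 metricD borelD R0_gt0 doubling_mu.
Let beta_ge0 : 0 <= beta := supercritical_beta_ge0 Cd_ge1 R0_gt0 beta_gt.
Let shell_lt1 := supercritical_shell_ratio_lt1 Cd_ge1 R0_gt0 beta_gt.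

Let measurable_preimage_mball :=
  measurable_completion_mball metricD geodesicD borelD eps_gt0 completionY.

Section CenteredBalls.
Context (a L r : R) (z : T).
Hypotheses (a_gt0 : 0 < a) (aL : a <= L) (r_gt0 : 0 < r).

Let L_gt0 : 0 < L := lt_le_trans a_gt0 aL.
Let K := interior_threshold R0 eps L.

Let K_ge : 2 * eps * L <= K. Proof. by rewrite le_max lexx. Qed.
Let K_gt0 : 0 < K. Proof. by apply: lt_le_trans K_ge; rewrite !mulr_gt0. Qed.

Lemma mu_beta_interior_comparable : K * r <= rho z ->
  mass_comparable nu (interior_const R0 Cd eps beta a L) (mball E z (a * r)) (mball E z (L * r)).
Proof.
move=> zK; have K_R0 : 2 * L <= K * R0 by rewrite -ler_pdivrMr// le_max lexx orbT.
apply: (mass_comparable_interior metricD geodesicD borelD R0_gt0 doubling_mu eps_gt0 beta_ge0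
          completionY).
- exact: mulr_gt0.
- by rewrite ler_pM2r.
- by apply: le_trans zK; rewrite mulrA ler_pM2r.
- by have := ler_wpM2r (ltW r_gt0) K_R0; have := ler_wpM2l (ltW R0_gt0) zK; lra.
- by rewrite !mulrA ler_pM2r// -ler_pdivrMr//; exact: le_exp2_truncnS.
Qed.

Lemma mu_beta_boundary_comparable : a <= 1 / 8 -> r <= 4 / eps -> far (2 * a * r) z ->
  rho z <= K * r ->
  mass_comparable nu (boundary_const M R0 Cd eps beta A a L)
    (mball E z (a * r)) (mball E z (L * r)).
Proof.
move=> a8 r_eps far_z zK; set s := inner_radius R0 eps a L.
have eK0 : 0 < expR (eps * R0) * K by rewrite mulr_gt0// expR_gt0.
have s0 : 0 < s by rewrite lt_min R0_gt0 divr_gt0.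
have sK : expR (eps * R0) * K * s <= a by rewrite mulrC -ler_pdivlMr// ge_min lexx orbT.
apply: (mass_comparable_shadow metricD geodesicD borelD R0_gt0 doubling_mu eps_gt0 beta_ge0
          completionY (s := s)) => //.
- exact: (measurable_d_eps_mball metricD geodesicD borelD eps_gt0 completionY).
- exact: (d_eps_mball_sub_shadow metricD geodesicD eps_gt0 completionY uniformE).
- by rewrite ge_min lexx.
- have es0 : 0 <= expR (eps * R0) * s by rewrite mulr_ge0 ?expR_ge0// ltW.
  by have := ler_wpM2l es0 zK; have := ler_wpM2r (ltW r_gt0) sK; lra.
- by rewrite -ler_pdivrMr//; exact: le_exp2_truncnS.
Qed.

Lemma mu_beta_d_eps_mball_comparable : a <= 1 / 8 -> r <= 4 / eps -> far (2 * a * r) z ->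
  mass_comparable nu (C a L) (mball E z (a * r)) (mball E z (L * r)).
Proof.
move=> a8 r_eps far_z; have Cd0 n : 0 <= Cd ^+ n by rewrite exprn_ge0// (le_trans ler01).
have [zK|/ltW Kz] := leP (K * r) (rho z).
  apply: mass_comparableW _ _ (lexx _) (lexx _) (mu_beta_interior_comparable zK).
  - by rewrite mulr_ge0 ?expR_ge0.
  - by rewrite !le_max lexx orbT.
apply: mass_comparableW _ _ (lexx _) (lexx _) (mu_beta_boundary_comparable a8 r_eps far_z Kz).
- by rewrite !mulr_ge0 ?expR_ge0// invr_ge0 subr_ge0 ltW.
- by rewrite !le_max lexx !orbT.
Qed.

End CenteredBalls.

Lemma mu_beta_corkscrew_comparable a L x z r : 0 < a -> a <= 1 / 8 -> a <= L + 1 ->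
  0 < r -> r <= 2 * diam E -> mball dY (iota z) (a * r) `<=` mball dY x r ->
  far (2 * a * r) z ->
  mass_comparable nuY (C a (L + 1)) (mball dY (iota z) (a * r)) (mball dY x (L * r)).
Proof.
move=> a0 a8 aL r0 r_diam sub far_z.
have r_eps : r <= 4 / eps.
  by have := diam_d_eps_le metricD geodesicD eps_gt0 completionY; lra.
have xz : dY x (iota z) < r.
  by apply: (sub (iota z)); rewrite /mball /= is_metric_refl// mulr_gt0.
have subL : mball dY x (L * r) `<=` mball dY (iota z) ((L + 1) * r).
  by apply: (subset_mball metricY); lra.
apply: (mass_comparableW (V := mball dY (iota z) ((L + 1) * r)) _ (lexx _) (lexx _)).
- exact: comparison_const_ge0.
- by apply: (le_mu_beta z0 mu beta metricD borelD) => // y; exact: subL.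
rewrite /mass_comparable !(preimage_completion_mball completionY).
exact: mu_beta_d_eps_mball_comparable.
Qed.

Lemma mu_beta_corkscrew_simeq a x z r : 0 < a -> a <= 1 / 8 ->
  0 < r -> r <= 2 * diam E -> mball dY (iota z) (a * r) `<=` mball dY x r ->
  far (2 * a * r) z ->
  (nuY (mball dY x r) <= (C a (1 + 1))%:E * nuY (mball dY (iota z) (a * r)))%E /\
  (nuY (mball dY (iota z) (a * r)) <= (C a (1 + 1))%:E * nuY (mball dY x r))%E.
Proof.
move=> a0 a8 r0 r_diam sub far_z; have a2 : a <= 1 + 1 by lra.
have [_ x_le _] := mu_beta_corkscrew_comparable a0 a8 a2 r0 r_diam sub far_z.
rewrite mul1r in x_le; split => //.
apply: (@le_trans _ _ (nuY (mball dY x r))).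
  by apply: (le_mu_beta z0 mu beta metricD borelD) => // y; exact: sub.
rewrite lee_pemull ?lee_fin ?comparison_const_ge1//.
by apply: integral_ge0 => y _; rewrite lee_fin expR_ge0.
Qed.

Lemma completion_doubling_upto_diam : exists K : R, forall x r, 0 < r -> r <= 2 * diam E ->
  [/\ (0 < nuY (mball dY x (2 * r)))%E,
      (nuY (mball dY x (2 * r)) <= K%:E * nuY (mball dY x r))%E
    & (nuY (mball dY x r) < +oo)%E].
Proof.
have A1 := uniform_const_ge1 metricD geodesicD eps_gt0 uniformE unboundedD.
set b := Num.min (1 / 8) (1 / (6 * A)).
have b0 : 0 < b by rewrite lt_min !divr_gt0//; lra.
pose a := b / 2; have a0 : 0 < a by rewrite divr_gt0.
have : a < b by rewrite /a; lra.
rewrite lt_min => /andP[a8 aA]; have a3 : a <= 2 + 1 by lra.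
exists (C a (2 + 1)) => x r r0 r_diam.
have [z [sub far_z]] :=
  corkscrew metricD geodesicD eps_gt0 completionY uniformE unboundedD x completeD a8 aA r0 r_diam.
have x_r2r : (nuY (mball dY x r) <= nuY (mball dY x (2 * r)))%E.
  by apply: (le_mu_beta z0 mu beta metricD borelD) => // y; rewrite /mball /=; lra.
have [] : mass_comparable nuY (C a (2 + 1)) (mball dY x r) (mball dY x (2 * r)).
  apply: mass_comparableW (comparison_const_ge0 _ _ _ _ _ _ _ _) (lexx _) _ (lexx _)
    (mu_beta_corkscrew_comparable a0 (ltW a8) a3 r0 r_diam sub far_z).
  by apply: (le_mu_beta z0 mu beta metricD borelD) => // y; exact: sub.
by move=> pos dbl fin; split => //; [exact: lt_le_trans x_r2r|exact: le_lt_trans fin].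
Qed.

Lemma completion_globally_doubling : globally_doubling dY nuY.
Proof.
have [K dbl] := completion_doubling_upto_diam; exists K => x r r0.
have [|diam_r] := leP r (2 * diam E); first exact: dbl.
have diam_gt0 := diam_d_eps_gt0 metricD geodesicD eps_gt0 completionY unboundedD.
have full s : diam E < s -> mball dY x s = setT.
  exact: (completion_mball_full metricD geodesicD eps_gt0 completionY).
have := dbl x (2 * diam E); rewrite !full; try lra.
by apply => //; lra.
Qed.

Lemma d_eps_globally_doubling : globally_doubling E nu.
Proof.
have [K dbl] := completion_globally_doubling; exists K => x r r0.
by have := dbl (iota x) r r0; rewrite !(preimage_completion_mball completionY).
Qed.

End Standing.

Theorem theorem4p9 (R : realType) (eps0 A : R -> R) (delta M eps Cd R0 beta : R) :
  BHK_property eps0 A ->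
  0 < eps -> eps <= eps0 delta ->
  17 * ln Cd / (3 * R0) < beta ->
  (forall (d : measure_display) (T : measurableType d) (D : T -> T -> R) (z0 : T)
          (mu : {measure set T -> \bar R}) (Y : Type) (dY : Y -> Y -> R) (iota : T -> Y),
     standing D z0 mu delta M R0 Cd ->
     completion_of (d_eps D z0 eps) dY iota ->
     globally_doubling dY (fun S => mu_beta D z0 mu beta (iota @^-1` S)) /\
     globally_doubling (d_eps D z0 eps) (mu_beta D z0 mu beta)) /\
  (forall a0 : R, 0 < a0 -> a0 < Num.min (1 / 8) (1 / (6 * A delta)) ->
   exists C : R, 1 <= C /\
   forall (d : measure_display) (T : measurableType d) (D : T -> T -> R) (z0 : T)
          (mu : {measure set T -> \bar R}) (Y : Type) (dY : Y -> Y -> R) (iota : T -> Y),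
     standing D z0 mu delta M R0 Cd ->
     completion_of (d_eps D z0 eps) dY iota ->
     forall (x : Y) (r : R), 0 < r -> r <= 2 * diam (d_eps D z0 eps) ->
       (exists z : T, mball dY (iota z) (a0 * r) `<=` mball dY x r /\
          forall w, bdry iota w -> 2 * a0 * r <= dY (iota z) w) /\
       (forall z : T, mball dY (iota z) (a0 * r) `<=` mball dY x r ->
          (forall w, bdry iota w -> 2 * a0 * r <= dY (iota z) w) ->
          (mu_beta D z0 mu beta (iota @^-1` mball dY x r)
             <= C%:E * mu_beta D z0 mu beta (iota @^-1` mball dY (iota z) (a0 * r)))%E /\
          (mu_beta D z0 mu beta (iota @^-1` mball dY (iota z) (a0 * r))
             <= C%:E * mu_beta D z0 mu beta (iota @^-1` mball dY x r))%E)).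
Proof.
move=> BHK eps_gt0 eps_le beta_gt.
split=> [d T D z0 mu Y dY iota st cY|a0 a0_gt0].
  have [uE _] := BHK T Y D z0 delta M eps dY iota st.1 eps_gt0 eps_le cY.
  by split; [exact: completion_globally_doubling st cY uE eps_gt0 beta_gt
            |exact: d_eps_globally_doubling st cY uE eps_gt0 beta_gt].
rewrite lt_min => /andP[a0_8 a0_A].
exists (comparison_const M R0 Cd eps beta (A delta) a0 (1 + 1)).
split=> [|d T D z0 mu Y dY iota st cY x r r0 r_diam]; first exact: comparison_const_ge1.
have [uE _] := BHK T Y D z0 delta M eps dY iota st.1 eps_gt0 eps_le cY.
have [[[mD [complD [unbD [gD _]]]] _] _] := st.
split; first exact: (corkscrew mD gD eps_gt0 cY uE unbD x complD a0_8 a0_A r0 r_diam).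
move=> z sub far_z.
exact: (mu_beta_corkscrew_simeq st cY uE eps_gt0 beta_gt a0_gt0 (ltW a0_8) r0 r_diam sub far_z).
Qed.
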